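(* The pair $(L^1, I)$ is the initial object of the category $\mathscr{B}$; that is, for each object $(F, v)$ of $\mathscr{B}$ there is exactly one map $(L^1, I) \to (F, v)$ in $\mathscr{B}$.
   Context: $\mathbb{F}$ is a fixed field, either $\mathbb{R}$ or $\mathbb{C}$. $\mathbf{Ban}$ is the category of Banach spaces over $\mathbb{F}$ and linear contractions (linear maps of norm $\le 1$). All measure spaces are finite, i.e. $\mu_X(X) < \infty$, where $\mu_X$ denotes the measure on $X$ (the empty measure space is allowed). An embedding $i \colon Y \to X$ of measure spaces is an injection such that $B \subseteq Y$ is measurable if and only if $iB \subseteq X$ is measurable, and in that case $\mu_Y(B) = \mu_X(iB)$. A measurable subset $A \subseteq X$ is given the unique measure space structure making the inclusion $A \hookrightarrow X$ an embedding. A measure-preserving partial map $(A, s) \colon X \to Y$ is a measurable subset $A \subseteq X$ together with a measure-preserving map $s \colon A \to Y$. The composite of $(A,s) \colon X \to Y$ and $(B,t) \colon Y \to Z$ is $(s^{-1}B, u)$, where $u(x) = t(s(x))$ for $x \in s^{-1}B$. $\mathbf{Mea}$ is the category of (finite) measure spaces and measure-preserving partial maps. For a functor $F \colon \mathbf{Mea}^{\mathrm{op}} \to \mathbf{Ban}$, an embedding $i \colon Y \to X$ gives the map $(iY, i^{-1}) \colon X \to Y$ in $\mathbf{Mea}$, and we write $Fi = F(iY, i^{-1}) \colon F(Y) \to F(X)$; a measure-preserving map $s \colon X \to Y$ gives the map $(X,s) \colon X \to Y$ in $\mathbf{Mea}$, and we write $Fs = F(X,s) \colon F(Y) \to F(X)$.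 Two embeddings $i \colon Y \to X$ and $j \colon Z \to X$ are complementary if $iY \cap jZ = \emptyset$ and $iY \cup jZ = X$. $\mathscr{B}$ is the category whose objects are pairs $(F, v)$ consisting of a functor $F \colon \mathbf{Mea}^{\mathrm{op}} \to \mathbf{Ban}$ and an element $v_X \in F(X)$ for each measure space $X$, such that: (I) $(Fi)(v_Y) + (Fj)(v_Z) = v_X$ for all complementary embeddings $i \colon Y \to X$, $j \colon Z \to X$; (II) $(Fs)(v_Y) = v_X$ for every measure-preserving map $s \colon X \to Y$; (III) $\|v_X\| \le \mu_X(X)$ for every measure space $X$. (A further axiom, $\|(Fi)(u) + (Fj)(w)\| \le \|u\| + \|w\|$ for complementary embeddings $i \colon Y \to X$, $j \colon Z \to X$ and $u \in F(Y)$, $w \in F(Z)$, is automatic since maps in $\mathbf{Ban}$ are contractions.) A map $(F', v') \to (F, v)$ in $\mathscr{B}$ is a natural transformation $\psi \colon F' \to F$ such that $\psi_X(v'_X) = v_X$ for all $X$. $L^1 \colon \mathbf{Mea}^{\mathrm{op}} \to \mathbf{Ban}$ is the functor sending $X$ to the usual Banach space $L^1(X)$ of $\mathbb{F}$-valued functions and sending $(A,s) \colon X \to Y$ to the map $L^1(Y) \to L^1(X)$, $g \mapsto (g \circ s)^X$, where $(g \circ s)^X$ is $g \circ s \colon A \to \mathbb{F}$ extended by zero to $X$. $I_X \in L^1(X)$ is the constant function $1$. The pair $(L^1, I)$ is an object of $\mathscr{B}$. *)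

(* Defs.v *)
From HB Require Import structures.
From mathcomp Require Import all_boot all_order all_algebra.
From mathcomp Require Import all_classical all_reals all_analysis.
From mathcomp Require Import ring lra.
From mathcomp Require Import measurable_realfun generic_quotient complex.

Set Implicit Arguments.
Unset Strict Implicit.
Unset Printing Implicit Defensive.

Import Order.TTheory GRing.Theory Num.Theory.
Import numFieldNormedType.Exports.

Local Open Scope classical_set_scope.
Local Open Scope ring_scope.

Record category := Category {
  obj : Type;
  hom : obj -> obj -> Type;
  idm : forall A, hom A A;
  comp : forall A B C, hom B C -> hom A B -> hom A C;
  comp_id_l : forall A B (f : hom A B), comp (idm B) f = f;
  comp_id_r : forall A B (f : hom A B), comp f (idm A) = f;
  comp_assoc : forall A B C D (f : hom A B) (g : hom B C) (h : hom C D),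
    comp h (comp g f) = comp (comp h g) f }.

Definition opposite (C : category) : category :=
  @Category (obj C) (fun A B => hom B A) (@idm C)
    (fun A B D g f => comp f g)
    (fun A B f => comp_id_r f) (fun A B f => comp_id_l f)
    (fun A B D E f g h => esym (comp_assoc h g f)).

Record functor (C D : category) := Functor {
  fobj : obj C -> obj D;
  fmap : forall A B, hom A B -> hom (fobj A) (fobj B);
  fmap_id : forall A, fmap (idm A) = idm (fobj A);
  fmap_comp : forall A B E (g : hom B E) (f : hom A B),
    fmap (comp g f) = comp (fmap g) (fmap f) }.

Record nat_trans (C D : category) (F G : functor C D) := NatTrans {
  component : forall A, hom (fobj F A) (fobj G A);
  naturality : forall A B (f : hom A B),
    comp (component B) (fmap F f) = comp (fmap G f) (component A) }.

Definition nat_id (C D : category) (F : functor C D) : nat_trans F F.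
refine (@NatTrans C D F F (fun A => idm _) _).
by move=> A B f; rewrite comp_id_l comp_id_r.
Defined.

Definition nat_comp (C D : category) (F G H : functor C D)
  (b : nat_trans G H) (a : nat_trans F G) : nat_trans F H.
refine (@NatTrans C D F H (fun A => comp (component b A) (component a A)) _).
by move=> A B f; rewrite -comp_assoc naturality comp_assoc naturality comp_assoc.
Defined.

Lemma nat_trans_ext (C D : category) (F G : functor C D) (a b : nat_trans F G) :
  (forall A, component a A = component b A) -> a = b.
Proof.
case: a b => [a aP] [b bP] /= ab.
have ab' : a = b by exact: functional_extensionality_dep.
by move: aP bP; rewrite ab' => aP bP; congr NatTrans; exact: Prop_irrelevance.
Qed.

Definition initial (C : category) (A : obj C) : Prop :=
  forall B : obj C, exists! f : hom A B, True.


(* The base field is either R or R[i].  Norms on spaces over R[i] take their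
   values in R[i] itself, so real bounds are compared through of_real. *)
Inductive base_field := RealNumbers | ComplexNumbers.

Definition scalar (R : realType) (k : base_field) : numFieldType :=
  match k with
  | RealNumbers => R
  | ComplexNumbers => R[i]
  end.

Section Scalars.
Variables (R : realType) (k : base_field).
Local Notation K := (scalar R k).

Definition scalar_Re : K -> R :=
  match k return scalar R k -> R with
  | RealNumbers => fun x => x
  | ComplexNumbers => fun z => complex.Re z
  end.

Definition scalar_Im : K -> R :=
  match k return scalar R k -> R with
  | RealNumbers => fun=> 0
  | ComplexNumbers => fun z => complex.Im z
  end.

Definition scalar_mk : R -> R -> K :=
  match k return R -> R -> scalar R k with
  | RealNumbers => fun a _ => a
  | ComplexNumbers => fun a b => Complex a b
  end.

Definition of_real (r : R) : K := scalar_mk r 0.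

Definition modulus (z : K) : R := scalar_Re `|z|.

End Scalars.
Arguments of_real {R k}.
Section ScalarTheory.
Variables (R : realType) (k : base_field).
Local Notation K := (scalar R k).
Local Notation Re := (@scalar_Re R k).
Local Notation Im := (@scalar_Im R k).
Local Notation mk := (@scalar_mk R k).

Lemma scalar_ReD (z w : K) : Re (z + w) = Re z + Re w.
Proof. by case: k z w => // -[? ?] [? ?]. Qed.
Lemma scalar_ImD (z w : K) : Im (z + w) = Im z + Im w.
Proof. by case: k z w => [? ?|[? ?] [? ?]] //=; rewrite addr0. Qed.
Lemma scalar_ReN (z : K) : Re (- z) = - Re z.
Proof. by case: k z => // -[]. Qed.
Lemma scalar_ImN (z : K) : Im (- z) = - Im z.
Proof. by case: k z => [?|[]] //=; rewrite oppr0. Qed.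
Lemma scalar_ReM (z w : K) : Re (z * w) = Re z * Re w - Im z * Im w.
Proof. by case: k z w => [? ?|[? ?] [? ?]] //=; rewrite mulr0 subr0. Qed.
Lemma scalar_ImM (z w : K) : Im (z * w) = Re z * Im w + Im z * Re w.
Proof. by case: k z w => [? ?|[? ?] [? ?]] //=; rewrite mulr0 mul0r addr0. Qed.
Lemma scalar_Re0 : Re 0 = 0. Proof. by case: k. Qed.
Lemma scalar_Im0 : Im 0 = 0. Proof. by case: k. Qed.
Lemma scalar_mk_Re a b : Re (mk a b) = a. Proof. by case: k. Qed.
Lemma scalar_Re_of_real r : Re (of_real r) = r. Proof. by case: k. Qed.
Lemma scalar_Im_of_real r : Im (of_real r) = 0. Proof. by case: k. Qed.
Lemma scalarK (z : K) : mk (Re z) (Im z) = z. Proof. by case: k z => // -[]. Qed.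

Lemma of_realD (r s : R) : of_real (r + s) = of_real r + of_real s :> K.
Proof. by rewrite /of_real; case: k => //=; apply/eqP; rewrite eq_complex /= addr0 !eqxx. Qed.
Lemma of_realM (r s : R) : of_real (r * s) = of_real r * of_real s :> K.
Proof.
by rewrite /of_real; case: k => //=; apply/eqP;
   rewrite eq_complex /= mulr0 subr0 mulr0 mul0r addr0 !eqxx.
Qed.
Lemma of_real0 : of_real 0 = 0 :> K. Proof. by case: k. Qed.
Lemma of_real1 : of_real 1 = 1 :> K. Proof. by case: k. Qed.
Lemma ler_of_real (r s : R) : (of_real r <= of_real s :> K) = (r <= s).
Proof. by rewrite /of_real; case: k => //=; rewrite lecE /= eqxx. Qed.
Lemma ltr_of_real (r s : R) : (of_real r < of_real s :> K) = (r < s).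
Proof. by rewrite /of_real; case: k => //=; rewrite ltcE /= eqxx. Qed.

Lemma modulusE (z : K) : modulus z = Num.sqrt (Re z ^+ 2 + Im z ^+ 2).
Proof.
rewrite /modulus; case: k z => z; first by rewrite /= expr0n addr0 sqrtr_sqr.
exact: (congr1 (@complex.Re R) (normc_def z)).
Qed.
Lemma normr_modulus (z : K) : `|z| = of_real (modulus z).
Proof. case: k z => //= z; exact: (etrans (normc_def z)).
Qed.
Lemma modulus_ge0 (z : K) : 0 <= modulus z.
Proof. by rewrite modulusE sqrtr_ge0. Qed.
Lemma of_real_inj : injective (@of_real R k).
Proof. by move=> r s /(congr1 Re); rewrite !scalar_Re_of_real. Qed.
Lemma modulusD (z w : K) : modulus (z + w) <= modulus z + modulus w.
Proof. by rewrite -ler_of_real of_realD -!normr_modulus ler_normD. Qed.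
Lemma modulusM (z w : K) : modulus (z * w) = modulus z * modulus w.
Proof. by apply: of_real_inj; rewrite of_realM -!normr_modulus normrM. Qed.
Lemma modulusN (z : K) : modulus (- z) = modulus z.
Proof. by apply: of_real_inj; rewrite -!normr_modulus normrN. Qed.
Lemma modulus0 : modulus (0 : K) = 0.
Proof. by apply: of_real_inj; rewrite -normr_modulus normr0 of_real0. Qed.
Lemma modulus1 : modulus (1 : K) = 1.
Proof. by apply: of_real_inj; rewrite -normr_modulus normr1 of_real1. Qed.
Lemma modulus0_eq0 (z : K) : modulus z = 0 -> z = 0.
Proof. by move=> z0; apply: normr0_eq0; rewrite normr_modulus z0 of_real0. Qed.
Lemma Re_le_modulus (z : K) : `|Re z| <= modulus z.
Proof. by rewrite modulusE -sqrtr_sqr ler_wsqrtr// lerDl sqr_ge0. Qed.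
Lemma Im_le_modulus (z : K) : `|Im z| <= modulus z.
Proof. by rewrite modulusE -sqrtr_sqr ler_wsqrtr// lerDr sqr_ge0. Qed.
Lemma modulus_le (z : K) : modulus z <= `|Re z| + `|Im z|.
Proof.
rewrite modulusE -[leRHS]ger0_norm ?addr_ge0// -sqrtr_sqr ler_wsqrtr//.
rewrite sqrrD !real_normK ?num_real// lerD2r lerDl.
by rewrite mulrn_wge0// mulr_ge0.
Qed.
End ScalarTheory.

Lemma some_preimage_image (T : Type) (A : set T) : Some @^-1` (Some @` A) = A.
Proof. by apply/seteqP; split=> [x [y Ay [<-]]//|x Ax]; exists x. Qed.

(* The library's measurableType is pointed, which would exclude the empty
   measure space.  As for the library's measures, mu is defined on all subsets,
   with no constraint beyond nonnegativity outside msets. *)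
Record meas_space (R : realType) := MeasSpace {
  points :> Type;
  msets : set (set points);
  mu : set points -> \bar R;
  msets_sigma_algebra : sigma_algebra [set: points] msets;
  mu_set0 : mu set0 = 0%E;
  mu_ge0 : forall A, (0 <= mu A)%E;
  mu_sigma_additive : forall F : (set points)^nat,
    (forall n, msets (F n)) -> trivIset [set: nat] F ->
    (\sum_(0 <= i < n) mu (F i))%E @[n --> \oo] --> mu (\bigcup_n F n);
  mu_finite : (mu [set: points] < +oo)%E }.

Section Mea.
Variable R : realType.
Implicit Types X Y Z : meas_space R.

(* A measure-preserving partial map (A, s) from X to Y is encoded by the function
   X -> option Y sending x to Some (s x) for x in A and to None otherwise: the
   preimage of Some @` B is s^-1 B, and that of Some @` setT is A. *)
Record mp_partial X Y := MpPartial {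
  partial_map :> X -> option Y;
  partial_mapP : forall B : set Y, msets B ->
    msets (partial_map @^-1` (Some @` B)) /\
    mu (partial_map @^-1` (Some @` B)) = mu B }.

Lemma mp_partial_ext X Y (s t : mp_partial X Y) : s =1 t -> s = t.
Proof.
case: s t => [s sP] [t tP] /= /funext st; move: sP tP; rewrite st => sP tP.
by congr MpPartial; exact: Prop_irrelevance.
Qed.

Program Definition mp_id X : mp_partial X X := @MpPartial X X Some _.
Next Obligation. by move=> X B mB; rewrite some_preimage_image. Qed.

Program Definition mp_comp X Y Z (t : mp_partial Y Z) (s : mp_partial X Y) :
  mp_partial X Z := @MpPartial X Z (fun x => obind t (s x)) _.
Next Obligation.
move=> X Y Z t s B mB; have [mtB tB] := partial_mapP t mB.
have [msB sB] := partial_mapP s mtB.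
suff -> : (fun x => obind t (s x)) @^-1` (Some @` B) =
  s @^-1` (Some @` (t @^-1` (Some @` B))) by rewrite sB tB.
apply/seteqP; split => x /=.
  by move=> [z Bz]; case: (s x) => //= y ty; exists y => //; exists z.
by move=> [y [z Bz tz] <-] /=; exists z.
Qed.

Definition Mea : category.
refine (@Category (meas_space R) mp_partial mp_id mp_comp _ _ _).
- by move=> X Y s; apply: mp_partial_ext => x /=; case: (s x).
- by move=> X Y s; apply: mp_partial_ext.
- by move=> X Y Z W s t u; apply: mp_partial_ext => x /=; case: (s x).
Defined.

Record embedding Y X := Embedding {
  emb :> Y -> X;
  emb_inj : injective emb;
  emb_measurable : forall B : set Y, msets B <-> msets (emb @` B);
  emb_mu : forall B : set Y, msets B -> mu B = mu (emb @` B) }.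

Definition complementary X Y Z (i : embedding Y X) (j : embedding Z X) : Prop :=
  range i `&` range j = set0 /\ range i `|` range j = [set: X].

Definition partial_inverse (T U : Type) (i : T -> U) (x : U) : option T :=
  match pselect (exists y, i y = x) with
  | left iy => Some (projT1 (cid iy))
  | right _ => None
  end.

Lemma partial_inverseP (T U : Type) (i : T -> U) x y : injective i ->
  partial_inverse i x = Some y <-> i y = x.
Proof.
move=> ij; rewrite /partial_inverse; case: pselect => [iy|niy].
  case: cid => z /= iz; split=> [[<-]//|iyx]; congr Some; apply: ij.
  by rewrite iz iyx.
by split=> // iyx; exfalso; apply: niy; exists y.
Qed.

(* The partial map (iY, i^-1) from X to Y. *)
Program Definition mp_embedding Y X (i : embedding Y X) : mp_partial X Y :=
  @MpPartial X Y (partial_inverse i) _.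
Next Obligation.
move=> Y X i B mB.
suff -> : partial_inverse i @^-1` (Some @` B) = i @` B.
  by split; [exact: (emb_measurable i B).1|rewrite -emb_mu].
apply/seteqP; split => [x [y By /esym/(partial_inverseP _ _ (@emb_inj _ _ i)) ixy]|].
  by exists y.
move=> _ [y By <-]; exists y => //; apply/esym/partial_inverseP => //.
exact: emb_inj.
Qed.

Record mp_map X Y := MpMap {
  total_map :> X -> Y;
  total_mapP : forall B : set Y, msets B ->
    msets (total_map @^-1` B) /\ mu (total_map @^-1` B) = mu B }.

Program Definition mp_total X Y (s : mp_map X Y) : mp_partial X Y :=
  @MpPartial X Y (Some \o s) _.
Next Obligation.
move=> X Y s B mB.
rewrite comp_preimage some_preimage_image; exact: total_mapP.
Qed.

End Mea.

Section Ban.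
Variables (R : realType) (k : base_field).
Local Notation K := (scalar R k).
Implicit Types V W U : completeNormedModType K.

Record contraction V W := Contraction {
  contr :> V -> W;
  contr_linear : linear contr;
  contr_norm : forall x, `|contr x| <= `|x| }.

Lemma contraction_ext V W (f g : contraction V W) : f =1 g -> f = g.
Proof.
case: f g => [f fl fn] [g gl gn] /= /funext fg.
move: fl fn gl gn; rewrite fg => fl fn gl gn.
by congr Contraction; exact: Prop_irrelevance.
Qed.

Definition contr_id V : contraction V V :=
  @Contraction V V id (fun _ _ _ => erefl) (fun _ => lexx _).

Program Definition contr_comp V W U (g : contraction W U) (f : contraction V W) :
  contraction V U := @Contraction V U (g \o f) _ _.
Next Obligation. by move=> V W U g f a x y /=; rewrite !contr_linear. Qed.
Next Obligation.
by move=> V W U g f x /=; apply: le_trans (contr_norm _ _) (contr_norm _ _).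
Qed.

Definition Ban : category.
refine (@Category (completeNormedModType K) contraction contr_id contr_comp _ _ _);
  by move=> *; apply: contraction_ext.
Defined.

End Ban.

Section CategoryB.
Variables (R : realType) (k : base_field).
Local Notation K := (scalar R k).
Implicit Types X Y Z : meas_space R.
Local Notation presheaf := (functor (opposite (Mea R)) (Ban R k)).

Definition value (F : presheaf) X : completeNormedModType K := fobj F X.

Definition pullback (F : presheaf) X Y (s : mp_partial X Y) :
  contraction (value F Y) (value F X) :=
  @fmap _ _ F Y X s.

Record B_object := BObject {
  B_functor : presheaf;
  B_point : forall X, value B_functor X;
  B_additive : forall X Y Z (i : embedding Y X) (j : embedding Z X),
    complementary i j ->
    pullback B_functor (mp_embedding i) (B_point Y) +
    pullback B_functor (mp_embedding j) (B_point Z) = B_point X;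
  B_invariant : forall X Y (s : mp_map X Y),
    pullback B_functor (mp_total s) (B_point Y) = B_point X;
  B_bounded : forall X, `|B_point X| <= of_real (fine (mu [set: X])) }.

Record B_hom (F' F : B_object) := BHom {
  B_nat :> nat_trans (B_functor F') (B_functor F);
  B_natP : forall X,
    (component B_nat X : contraction (value _ X) (value _ X)) (B_point F' X) =
    B_point F X }.

Lemma B_hom_ext (F G : B_object) (a b : B_hom F G) :
  (forall X, component a X = component b X) -> a = b.
Proof.
case: a b => [a aP] [b bP] /= h; have ab := nat_trans_ext (C := opposite (Mea R)) (D := Ban R k) h.
move: aP bP; rewrite ab => aP bP.
by congr BHom; exact: Prop_irrelevance.
Qed.

Definition B_id (F : B_object) : B_hom F F := @BHom F F (nat_id _) (fun=> erefl).

Program Definition B_comp (F G H : B_object) (b : B_hom G H) (a : B_hom F G) :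
  B_hom F H := @BHom F H (nat_comp b a) _.
Next Obligation. by move=> F G H b a X /=; rewrite !B_natP. Qed.

Definition B : category.
refine (@Category B_object B_hom B_id B_comp _ _ _).
- by move=> F G a; apply: B_hom_ext => X; exact: comp_id_l.
- by move=> F G a; apply: B_hom_ext => X; exact: comp_id_r.
- by move=> F G H I a b c; apply: B_hom_ext => X; exact: comp_assoc.
Defined.

End CategoryB.

(* X with one extra point None of measure zero.  It is pointed even when X is
   empty, so that functions on X, extended by 0 at None, can be integrated with
   the library's integral. *)
Section Adjoin.
Context {R : realType} (X : meas_space R).

Definition adjoin : Type := option X.

HB.instance Definition _ := gen_eqMixin adjoin.
HB.instance Definition _ := gen_choiceMixin adjoin.
HB.instance Definition _ := isPointed.Build adjoin None.

Definition adjoin_measurable : set (set adjoin) :=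
  [set A | msets (Some @^-1` A)].

Fact adjoin_measurable0 : adjoin_measurable set0.
Proof. by rewrite /adjoin_measurable/= preimage_set0; have [] := msets_sigma_algebra X. Qed.

Fact adjoin_measurableC A : adjoin_measurable A -> adjoin_measurable (~` A).
Proof.
by rewrite /adjoin_measurable/= preimage_setC -setTD;
   have [_ + _] := msets_sigma_algebra X; apply.
Qed.

Fact adjoin_measurable_bigcup (F : (set adjoin)^nat) :
  (forall n, adjoin_measurable (F n)) -> adjoin_measurable (\bigcup_n F n).
Proof.
by move=> mF; rewrite /adjoin_measurable/= preimage_bigcup;
   have [_ _] := msets_sigma_algebra X; apply.
Qed.

HB.instance Definition _ := @isMeasurable.Build default_measure_display adjoin
  adjoin_measurable adjoin_measurable0 adjoin_measurableC
  adjoin_measurable_bigcup.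

Definition adjoin_mu (A : set adjoin) : \bar R := mu (Some @^-1` A).

Fact adjoin_mu0 : adjoin_mu set0 = 0%E.
Proof. by rewrite /adjoin_mu preimage_set0 mu_set0. Qed.

Fact adjoin_mu_ge0 A : (0 <= adjoin_mu A)%E.
Proof. exact: mu_ge0. Qed.

Fact adjoin_mu_semi_sigma_additive : semi_sigma_additive adjoin_mu.
Proof.
move=> F mF tF _; rewrite /adjoin_mu preimage_bigcup.
apply: (mu_sigma_additive mF).
by move=> i j _ _ [x [Fix Fjx]]; apply: tF => //; exists (Some x).
Qed.

HB.instance Definition _ := isMeasure.Build _ adjoin R adjoin_mu
  adjoin_mu0 adjoin_mu_ge0 adjoin_mu_semi_sigma_additive.

Fact adjoin_mu_fin : fin_num_fun adjoin_mu.
Proof.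
move=> A mA; rewrite ge0_fin_numE ?adjoin_mu_ge0//.
apply: le_lt_trans (mu_finite X).
have -> : mu [set: X] = adjoin_mu [set: adjoin] by rewrite /adjoin_mu preimage_setT.
by apply: le_measure; rewrite ?inE.
Qed.

HB.instance Definition _ := Measure_isFinite.Build _ adjoin R adjoin_mu
  adjoin_mu_fin.

End Adjoin.

Section IntegrableFunctions.
Context {R : realType} {k : base_field} (X : meas_space R).
Local Notation K := (scalar R k).

Definition space_integral (h : X -> R) : \bar R :=
  (\int[adjoin_mu (X := X)]_(z in [set: adjoin X]) (oapp h 0 z)%:E)%E.

(* Borel measurability of the real and imaginary parts. *)
Definition scalar_measurable (f : X -> K) : Prop :=
  forall B : set R, measurable B ->
    msets (f @^-1` (@scalar_Re R k @^-1` B)) /\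
    msets (f @^-1` (@scalar_Im R k @^-1` B)).

Definition integrable_fun (f : X -> K) : Prop :=
  scalar_measurable f /\ (space_integral (fun x => modulus (f x)) < +oo)%E.

Definition ae_equal (f g : X -> K) : Prop :=
  exists N : set X, [/\ msets N, mu N = 0%E & forall x, f x <> g x -> N x].
End IntegrableFunctions.

Section IntegrableTheory.
Context {R : realType} {k : base_field} (X : meas_space R).
Local Notation K := (scalar R k).
Local Notation Re := (@scalar_Re R k).
Local Notation Im := (@scalar_Im R k).
Local Notation ext f := (oapp f 0).
Implicit Types f g : X -> K.

Lemma scalar_measurableP f : scalar_measurable f <->
  measurable_fun [set: adjoin X] (fun z => Re (ext f z)) /\
  measurable_fun [set: adjoin X] (fun z => Im (ext f z)).
Proof.
split=> [mf|[mr mi] B mB].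
  by split=> _ B mB; rewrite setTI; have [] := mf B mB.
split; [have := mr measurableT B mB|have := mi measurableT B mB];
  by rewrite setTI.
Qed.

Lemma measurable_sqrt : measurable_fun [set: R] (@Num.sqrt R).
Proof. by apply: continuous_measurable_fun; exact: sqrt_continuous. Qed.

Lemma scalar_measurable_modulus f : scalar_measurable f ->
  measurable_fun [set: adjoin X] (fun z => modulus (ext f z)).
Proof.
move=> /scalar_measurableP[mr mi].
under eq_fun do rewrite modulusE.
apply: measurableT_comp; first exact: measurable_sqrt.
by apply: measurable_funD; exact: measurable_funX.
Qed.

Lemma ext_modulus f z : oapp (fun x => modulus (f x)) 0 z = modulus (ext f z).
Proof. by case: z => //=; rewrite modulus0. Qed.
Lemma extD f g z : ext (f + g) z = ext f z + ext g z.
Proof. by case: z => //=; rewrite addr0. Qed.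
Lemma extN f z : ext (- f) z = - ext f z.
Proof. by case: z => //=; rewrite oppr0. Qed.
Lemma extZ (c : K) f z : ext (fun x => c * f x) z = c * ext f z.
Proof. by case: z => //=; rewrite mulr0. Qed.

Lemma scalar_measurable0 : scalar_measurable (fun _ : X => 0 : K).
Proof.
apply/scalar_measurableP; split.
  by rewrite (_ : (fun z => _) = cst (Re 0)); [exact: measurable_cst|apply/funext; case].
by rewrite (_ : (fun z => _) = cst (Im 0)); [exact: measurable_cst|apply/funext; case].
Qed.

Lemma scalar_measurableD f g : scalar_measurable f -> scalar_measurable g ->
  scalar_measurable (f + g).
Proof.
move=> /scalar_measurableP[fr fi] /scalar_measurableP[gr gi].
apply/scalar_measurableP; split.
  by under eq_fun do rewrite extD scalar_ReD; exact: measurable_funD.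
by under eq_fun do rewrite extD scalar_ImD; exact: measurable_funD.
Qed.

Lemma scalar_measurableN f : scalar_measurable f -> scalar_measurable (- f).
Proof.
move=> /scalar_measurableP[fr fi].
apply/scalar_measurableP; split.
  by under eq_fun do rewrite extN scalar_ReN; exact: measurableT_comp.
by under eq_fun do rewrite extN scalar_ImN; exact: measurableT_comp.
Qed.

Lemma scalar_measurableZ (c : K) f :
  scalar_measurable f -> scalar_measurable (fun x => c * f x).
Proof.
move=> /scalar_measurableP[fr fi].
apply/scalar_measurableP; split.
  under eq_fun do rewrite extZ scalar_ReM.
  by apply: measurable_funB; exact: measurable_funM.
under eq_fun do rewrite extZ scalar_ImM.
by apply: measurable_funD; exact: measurable_funM.
Qed.

Definition L1norm (f : X -> K) : \bar R :=
  space_integral (fun x => modulus (f x)).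

Lemma L1normE f : L1norm f =
  (\int[adjoin_mu (X := X)]_(z in [set: adjoin X]) (modulus (ext f z))%:E)%E.
Proof. by apply: eq_integral => z _; rewrite ext_modulus. Qed.

Lemma L1norm_ge0 f : (0 <= L1norm f)%E.
Proof. by rewrite L1normE integral_ge0// => z _; rewrite lee_fin modulus_ge0. Qed.

Lemma L1normD f g : scalar_measurable f -> scalar_measurable g ->
  (L1norm (f + g)%R <= L1norm f + L1norm g)%E.
Proof.
move=> mf mg; rewrite !L1normE -ge0_integralD//=.
- apply: ge0_le_integral => //=.
  + by move=> z _; rewrite lee_fin modulus_ge0.
  + by apply/measurable_EFinP/scalar_measurable_modulus/scalar_measurableD.
  + by apply/measurable_EFinP; apply: measurable_funD; exact: scalar_measurable_modulus.
  + by move=> z _; rewrite lee_fin extD modulusD.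
- by move=> z _; rewrite lee_fin modulus_ge0.
- exact/measurable_EFinP/scalar_measurable_modulus.
- by move=> z _; rewrite lee_fin modulus_ge0.
- exact/measurable_EFinP/scalar_measurable_modulus.
Qed.

Lemma L1normN f : L1norm (- f) = L1norm f.
Proof. by rewrite !L1normE; apply: eq_integral => z _; rewrite extN modulusN. Qed.

Lemma L1normZ (c : K) f : scalar_measurable f ->
  L1norm (fun x => c * f x) = ((modulus c)%:E * L1norm f)%E.
Proof.
move=> mf; rewrite !L1normE -ge0_integralZl_EFin//.
- by apply: eq_integral => z _; rewrite extZ modulusM.
- by move=> z _; rewrite lee_fin modulus_ge0.
- exact/measurable_EFinP/scalar_measurable_modulus.
- exact: modulus_ge0.
Qed.

Lemma L1norm0 : L1norm (fun=> 0) = 0%E.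
Proof.
rewrite L1normE; under eq_integral.
  move=> z _; rewrite (_ : ext _ z = 0) ?modulus0; last by case: z.
  over.
exact: integral0.
Qed.

Lemma integrable_fun_Lt f : integrable_fun f -> (L1norm f < +oo)%E.
Proof. by case. Qed.

Lemma L1norm_fin f : integrable_fun f -> L1norm f \is a fin_num.
Proof. by case=> _ fi; rewrite ge0_fin_numE// L1norm_ge0. Qed.

Lemma integrable_fun0 : integrable_fun (fun _ : X => 0 : K).
Proof. by split; [exact: scalar_measurable0|rewrite -/(L1norm _) L1norm0]. Qed.

Lemma integrable_funD f g : integrable_fun f -> integrable_fun g ->
  integrable_fun (f + g).
Proof.
move=> [mf fi] [mg gi]; split; first exact: scalar_measurableD.
by apply: le_lt_trans (L1normD mf mg) _; rewrite lte_add_pinfty.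
Qed.

Lemma integrable_funN f : integrable_fun f -> integrable_fun (- f).
Proof.
move=> [mf fi]; split; first exact: scalar_measurableN.
by rewrite -/(L1norm _) L1normN.
Qed.

Lemma integrable_funZ (c : K) f :
  integrable_fun f -> integrable_fun (fun x => c * f x).
Proof.
move=> fi; have [mf _] := fi; split; first exact: scalar_measurableZ.
rewrite -/(L1norm _) L1normZ// -(fineK (L1norm_fin fi)) -EFinM.
exact: ltry.
Qed.

Lemma ae_equalP f g : scalar_measurable f -> scalar_measurable g ->
  ae_equal f g <-> L1norm (f - g) = 0%E.
Proof.
move=> mf mg.
have mfg : scalar_measurable (f - g).
  by apply: scalar_measurableD => //; exact: scalar_measurableN.
have mm := scalar_measurable_modulus mfg.
have e0 : (\int[adjoin_mu (X := X)]_(z in [set: adjoin X])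
    `| (modulus (ext (f - g)%R z))%:E |)%E = L1norm (f - g).
  rewrite L1normE; apply: eq_integral => z _.
  by rewrite gee0_abs// lee_fin modulus_ge0.
have := ae_eq_integral_abs (adjoin_mu (X := X)) measurableT
  (f := fun z => (modulus (ext (f - g) z))%:E) (iffRL (measurable_EFinP _ _) mm).
rewrite e0 => ->; split.
  move=> [N [mN N0 fgN]]; exists (Some @` N); split.
  - rewrite /measurable/= /adjoin_measurable/=.
    by rewrite some_preimage_image.
  - by rewrite /= /adjoin_mu some_preimage_image.
  case=> [x|] /= h; last by exfalso; apply: h => _; rewrite modulus0.
  exists x => //; apply: fgN => fg; apply: h => _.
  by rewrite /GRing.add/= /GRing.opp/= fg subrr modulus0.
move=> [N [mN N0 fgN]]; exists (Some @^-1` N); split => // x fg.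
apply: fgN => /= /(_ Logic.I)/= [] /modulus0_eq0/eqP.
by rewrite subr_eq0 => /eqP.
Qed.

Lemma ae_equal_refl f : ae_equal f f.
Proof.
exists set0; split => //; last exact: mu_set0.
by have [] := msets_sigma_algebra X.
Qed.

Lemma ae_equal_sym f g : ae_equal f g -> ae_equal g f.
Proof. by move=> [N [? ? h]]; exists N; split=> // x gf; apply/h/nesym. Qed.

End IntegrableTheory.

Section RieszFischer.
Context {R : realType} {k : base_field} (X : meas_space R).
Local Notation K := (scalar R k).
Local Notation Re := (@scalar_Re R k).
Local Notation Im := (@scalar_Im R k).
Local Notation mk := (@scalar_mk R k).
Local Notation ext f := (oapp f 0).
Local Notation mX := (adjoin_mu (X := X)).

Lemma scalar_cvg (u : nat -> K) (a b : R) :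
  Re (u n) @[n --> \oo] --> a -> Im (u n) @[n --> \oo] --> b ->
  Re (u n) @[n --> \oo] --> Re (mk a b) /\
  Im (u n) @[n --> \oo] --> Im (mk a b).
Proof.
move=> ua ub; split; first by rewrite scalar_mk_Re.
case: k u {ua} ub => // u _; exact: cvg_cst.
Qed.

Lemma modulus_cvg (u : nat -> K) (w : K) :
  Re (u n) @[n --> \oo] --> Re w -> Im (u n) @[n --> \oo] --> Im w ->
  modulus (u n) @[n --> \oo] --> modulus w.
Proof.
move=> ua ub; rewrite modulusE; under eq_fun do rewrite modulusE.
apply: continuous_cvg; first exact: sqrt_continuous.
by apply: cvgD; rewrite ?expr2; under eq_fun do rewrite expr2; exact: cvgM.
Qed.

Lemma dominated_telescope_cvg (u D : nat -> R) :
  (forall n, `|u n.+1 - u n| <= D n) -> (\sum_(0 <= n <oo) (D n)%:E < +oo)%E ->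
  cvgn u.
Proof.
move=> uD Doo.
have D0 n : 0 <= D n by apply: le_trans (uD n).
have cD : cvgn (series D).
  apply: nondecreasing_is_cvgn.
    by apply/nondecreasing_seqP => n; rewrite !seriesEnat/= big_nat_recr//= lerDl.
  exists (fine (\sum_(0 <= n <oo) (D n)%:E)%E) => _ [n _ <-].
  rewrite -lee_fin fineK; last first.
    by rewrite ge0_fin_numE// nneseries_ge0// => i _ _; rewrite lee_fin.
  rewrite seriesEnat/= -sumEFin; apply: nneseries_lim_ge => i _ _.
  by rewrite lee_fin.
have ct : cvgn (series (telescope u)).
  apply: normed_cvg; apply: (series_le_cvg _ D0 uD cD) => n.
  exact: normr_ge0.
have -> : u = (fun n => u 0%N + series (telescope u) n).
  by apply/funext => n; exact: eq_sum_telescope.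
by apply: is_cvgD => //; exact: is_cvg_cst.
Qed.

Lemma limn_einf_le (u : (\bar R)^nat) (c : \bar R) (N : nat) :
  (forall n, (N <= n)%N -> (u n <= c)%E) -> (limn_einf u <= c)%E.
Proof.
move=> uc; rewrite limn_einf_lim; apply: lime_le; first exact: is_cvg_einfs.
exists N => // n /= Nn; apply: le_trans (uc n Nn).
by apply: ereal_inf_lbound; exists n => /=.
Qed.

(* Completeness of L^1 along rapidly Cauchy sequences. *)
Lemma riesz_fischer (f : nat -> X -> K) :
  (forall n, integrable_fun (f n)) ->
  (forall n m, (n <= m)%N -> (L1norm (f m - f n)%R <= (1 / 2 ^+ n)%:E)%E) ->
  exists2 g, integrable_fun g &
    forall n, (L1norm (f n - g)%R <= (1 / 2 ^+ n)%:E)%E.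
Proof.
move=> fi fC.
have mf n : scalar_measurable (f n) by have [] := fi n.
have mfB n m : scalar_measurable (f m - f n).
  by apply: scalar_measurableD => //; exact: scalar_measurableN.
pose D n z := modulus (ext (f n.+1 - f n) z).
have D0 n z : 0 <= D n z by exact: modulus_ge0.
have mD n : measurable_fun [set: adjoin X] (D n).
  exact: scalar_measurable_modulus.
pose G z := (\sum_(0 <= n <oo) (D n z)%:E)%E.
have G0 z : (0 <= G z)%E by apply: nneseries_ge0 => n _ _; rewrite lee_fin.
have mG : measurable_fun [set: adjoin X] G.
  apply: ge0_emeasurable_sum => // n.
    by move=> z _ _; rewrite lee_fin.
  by move=> _; exact/measurable_EFinP.
have iG : mX.-integrable [set: adjoin X] G.
  apply/integrableP; split => //.
  under eq_integral do rewrite gee0_abs//.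
  rewrite integral_nneseries//; last 2 first.
    by move=> n; exact/measurable_EFinP.
    by move=> n z _; rewrite lee_fin.
  apply: (@le_lt_trans _ _ (\sum_(0 <= n <oo) ((2 / (2 ^ (n + 0).+1)%:R : R)%:E))%E).
    apply: lee_nneseries => [n _ _|n _].
      by apply: integral_ge0 => z _; rewrite lee_fin.
    rewrite -L1normE; apply: le_trans (fC n n.+1 (leqnSn n)) _.
    rewrite lee_fin addn0 natrX exprS invfM mulrA divff ?mul1r//.
  have := @cvg_geometric_eseries_half R 2 0.
  under [X in X @ _ --> _ -> _]eq_fun do under eq_fun do rewrite addnS.
  by move/cvg_lim => ->//; rewrite ltry.
have [E0 [mE0 E00 GE0]] := integrable_ae measurableT iG.
pose S := ~` E0.
have mS : measurable S by exact: measurableC.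
have cR z : cvgn (fun n => Re (ext (f n) z) * \1_S z).
  have [Sz|Sz] := pselect (S z); last first.
    by under eq_fun do rewrite indicE memNset// mulr0; exact: is_cvg_cst.
  under eq_fun do rewrite indicE mem_set// mulr1.
  apply: (@dominated_telescope_cvg _ (D ^~ z)).
    by move=> n; rewrite -scalar_ReN -scalar_ReD -extN -extD; exact: Re_le_modulus.
  rewrite -/(G z) -ge0_fin_numE//; apply: contrapT => nG.
  by apply: Sz; apply: GE0 => /= /(_ Logic.I).
have cI z : cvgn (fun n => Im (ext (f n) z) * \1_S z).
  have [Sz|Sz] := pselect (S z); last first.
    by under eq_fun do rewrite indicE memNset// mulr0; exact: is_cvg_cst.
  under eq_fun do rewrite indicE mem_set// mulr1.
  apply: (@dominated_telescope_cvg _ (D ^~ z)).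
    by move=> n; rewrite -scalar_ImN -scalar_ImD -extN -extD; exact: Im_le_modulus.
  rewrite -/(G z) -ge0_fin_numE//; apply: contrapT => nG.
  by apply: Sz; apply: GE0 => /= /(_ Logic.I).
pose h n x : K := f n x * of_real (\1_S (Some x)).
have exth n z : ext (h n) z = ext (f n) z * of_real (\1_S z).
  by case: z => //=; rewrite mul0r.
have Reh n z : Re (ext (h n) z) = Re (ext (f n) z) * \1_S z.
  by rewrite exth scalar_ReM scalar_Re_of_real scalar_Im_of_real mulr0 subr0.
have Imh n z : Im (ext (h n) z) = Im (ext (f n) z) * \1_S z.
  by rewrite exth scalar_ImM scalar_Re_of_real scalar_Im_of_real mulr0 add0r.
pose g (x : X) : K := mk (limn (fun n => Re (ext (h n) (Some x))))
  (limn (fun n => Im (ext (h n) (Some x)))).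
have cg z : Re (ext (h n) z) @[n --> \oo] --> Re (ext g z) /\
    Im (ext (h n) z) @[n --> \oo] --> Im (ext g z).
  case: z => [x|]; last by split=> /=; exact: cvg_cst.
  apply: (scalar_cvg (u := fun n => ext (h n) (Some x))).
    by under eq_fun do rewrite Reh; exact: (cR (Some x)).
  by under eq_fun do rewrite Imh; exact: (cI (Some x)).
have mg : scalar_measurable g.
  apply/scalar_measurableP; split.
    apply: (@measurable_fun_cvg _ (adjoin X) R setT (fun n z => Re (ext (h n) z)) (fun z => Re (ext g z))).
      move=> n; under eq_fun do rewrite Reh.
      have /scalar_measurableP[? _] := mf n.
      by apply: measurable_funM => //; exact: measurable_indic.
    by move=> z _; have [] := cg z.
  apply: (@measurable_fun_cvg _ (adjoin X) R setT (fun n z => Im (ext (h n) z)) (fun z => Im (ext g z))).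
    move=> n; under eq_fun do rewrite Imh.
    have /scalar_measurableP[_ ?] := mf n.
    by apply: measurable_funM => //; exact: measurable_indic.
  by move=> z _; have [] := cg z.
have mfg n : scalar_measurable (f n - g).
  by apply: scalar_measurableD => //; exact: scalar_measurableN.
have fg n : (L1norm (f n - g)%R <= (1 / 2 ^+ n)%:E)%E.
  rewrite L1normE (@ge0_negligible_integral _ _ _ mX _ E0)//; last 2 first.
    exact/measurable_EFinP/scalar_measurable_modulus.
    by move=> z _; rewrite lee_fin modulus_ge0.
  rewrite setTD -/S.
  have -> : (\int[mX]_(z in S) (modulus (ext (f n - g)%R z))%:E)%E =
     (\int[mX]_(z in S) limn_einf (fun m => (modulus (ext (f n - f m)%R z))%:E))%E.
    apply: eq_integral => z /set_mem Sz; apply/esym.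
    have [ca cb] := cg z.
    apply: (cvg_limn_einf_sup _).1; apply: cvg_EFin; first exact: nearW.
    apply: modulus_cvg.
      rewrite extD extN scalar_ReD scalar_ReN.
      rewrite (_ : (fun m => Re (ext (f n - f m) z)) = fun m => Re (ext (f n) z) - Re (ext (h m) z)); last first.
        by apply/funext => m /=; rewrite extD extN scalar_ReD scalar_ReN Reh indicE mem_set// mulr1.
      by apply: cvgB => //; exact: cvg_cst.
    rewrite extD extN scalar_ImD scalar_ImN.
    rewrite (_ : (fun m => Im (ext (f n - f m) z)) = fun m => Im (ext (f n) z) - Im (ext (h m) z)); last first.
      by apply/funext => m /=; rewrite extD extN scalar_ImD scalar_ImN Imh indicE mem_set// mulr1.
    by apply: cvgB => //; exact: cvg_cst.
  apply: le_trans (fatou mX mS _ _) _.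
  - move=> m; apply/measurable_EFinP; apply: measurable_funTS.
    exact: scalar_measurable_modulus.
  - by move=> m z _; rewrite lee_fin modulus_ge0.
  apply: (@limn_einf_le _ _ n) => m nm; apply: le_trans (fC n m nm).
  rewrite -(L1normN (f m - f n)) opprB L1normE.
  apply: ge0_subset_integral => //.
    exact/measurable_EFinP/scalar_measurable_modulus.
  by move=> z _; rewrite lee_fin modulus_ge0.
exists g => //.
have -> : g = f 0%N - (f 0%N - g) by rewrite opprB addrCA subrr addr0.
apply: integrable_funD => //; apply: integrable_funN; split => //.
by apply: le_lt_trans (fg 0%N) _; rewrite ltry.
Qed.
End RieszFischer.

Record integrable_type {R : realType} (k : base_field) (X : meas_space R) :=
  IntegrableFun {
    integrable_val :> X -> scalar R k;
    integrable_valP : integrable_fun integrable_val }.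

Section L1.
Context {R : realType} (k : base_field) (X : meas_space R).
Local Notation K := (scalar R k).
Local Notation iT := (integrable_type k X).

HB.instance Definition _ := gen_eqMixin iT.
HB.instance Definition _ := gen_choiceMixin iT.

Definition ae_equalb (f g : iT) : bool := `[< ae_equal f g >].

Lemma ae_equal_trans (f g h : X -> K) :
  ae_equal f g -> ae_equal g h -> ae_equal f h.
Proof.
move=> [N [mN N0 fg]] [M [mM M0 gh]].
have mNM : measurable (Some @` N `|` Some @` M : set (adjoin X)).
  by apply: measurableU; rewrite /measurable/= /adjoin_measurable/= some_preimage_image.
exists (N `|` M); split.
- by move: mNM; rewrite /measurable/= /adjoin_measurable/= preimage_setU !some_preimage_image.
- have : (adjoin_mu (X := X) (Some @` N `|` Some @` M) = 0)%E.
    apply: null_set_setU; rewrite /= ?/adjoin_mu ?some_preimage_image//.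
    + by rewrite /measurable/= /adjoin_measurable/= some_preimage_image.
    + by rewrite /measurable/= /adjoin_measurable/= some_preimage_image.
  by rewrite /adjoin_mu preimage_setU !some_preimage_image.
- move=> x fhx; apply: contrapT => /not_orP[Nx Mx]; apply: fhx.
  rewrite (_ : f x = g x); last by apply: contrapT => /fg.
  by apply: contrapT => /gh.
Qed.

Fact ae_equalb_refl : reflexive ae_equalb.
Proof. by move=> f; apply/asboolP; exact: ae_equal_refl. Qed.
Fact ae_equalb_sym : symmetric ae_equalb.
Proof. by move=> f g; apply/idP/idP => /asboolP h; apply/asboolP/ae_equal_sym. Qed.
Fact ae_equalb_trans : transitive ae_equalb.
Proof. by move=> f g h /asboolP gf /asboolP fh; apply/asboolP/(ae_equal_trans gf fh). Qed.

Canonical ae_equalb_equiv :=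
  EquivRel ae_equalb ae_equalb_refl ae_equalb_sym ae_equalb_trans.

Definition L1 : Type := {eq_quot ae_equalb}%qT.
HB.instance Definition _ := Choice.on L1.
HB.instance Definition _ := EqQuotient.on L1.

Definition L1_class (f : X -> K) (fi : integrable_fun f) : L1 :=
  \pi_L1%qT (IntegrableFun fi).

Lemma L1_classP (u : L1) : exists f (fi : integrable_fun f), u = L1_class fi.
Proof.
elim/quotW: u => -[f fi]; by exists f, fi.
Qed.

Lemma L1_class_eq (f g : X -> K) (fi : integrable_fun f) (gi : integrable_fun g) :
  L1_class fi = L1_class gi <-> ae_equal f g.
Proof.
split=> [/eqP|fg].
  by rewrite /L1_class eqmodE => /asboolP.
by apply/eqP; rewrite /L1_class eqmodE; exact/asboolP.
Qed.

Lemma L1_class_ext (f g : X -> K) (fi : integrable_fun f) (gi : integrable_fun g) :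
  f =1 g -> L1_class fi = L1_class gi.
Proof. by move=> fg; apply/L1_class_eq; rewrite (funext fg); exact: ae_equal_refl. Qed.

Definition L1_add (u v : L1) : L1 :=
  L1_class (integrable_funD (integrable_valP (repr u)) (integrable_valP (repr v))).
Definition L1_opp (u : L1) : L1 :=
  L1_class (integrable_funN (integrable_valP (repr u))).
Definition L1_zero : L1 := L1_class (integrable_fun0 X).
Definition L1_scale (c : K) (u : L1) : L1 :=
  L1_class (integrable_funZ c (integrable_valP (repr u))).
Definition L1_norm (u : L1) : K := of_real (fine (L1norm (repr u))).

Lemma L1_repr f (fi : integrable_fun f) : ae_equal (repr (L1_class fi)) f.
Proof.
have := reprK (L1_class fi); rewrite {2}/L1_class => /eqP.
by rewrite eqmodE => /asboolP.
Qed.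

Lemma L1_addE f g (fi : integrable_fun f) (gi : integrable_fun g) :
  L1_add (L1_class fi) (L1_class gi) = L1_class (integrable_funD fi gi).
Proof.
apply/L1_class_eq.
apply: (@ae_equal_trans _ (f + repr (L1_class gi))).
  have [N [mN N0 h]] := L1_repr fi; exists N; split => // x fx.
  by apply: h; apply: contra_not fx; rewrite /GRing.add/= => ->.
have [N [mN N0 h]] := L1_repr gi; exists N; split => // x fx.
by apply: h; apply: contra_not fx; rewrite /GRing.add/= => ->.
Qed.

Lemma L1_oppE f (fi : integrable_fun f) :
  L1_opp (L1_class fi) = L1_class (integrable_funN fi).
Proof.
apply/L1_class_eq.
have [N [mN N0 h]] := L1_repr fi; exists N; split => // x fx.
by apply: h; apply: contra_not fx; rewrite /GRing.opp/= => ->.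
Qed.

Lemma L1_scaleE c f (fi : integrable_fun f) :
  L1_scale c (L1_class fi) = L1_class (integrable_funZ c fi).
Proof.
apply/L1_class_eq.
have [N [mN N0 h]] := L1_repr fi; exists N; split => // x fx.
by apply: h; apply: contra_not fx => ->.
Qed.

Lemma ae_equal_L1norm (f g : X -> K) : integrable_fun f -> integrable_fun g ->
  ae_equal f g -> L1norm f = L1norm g.
Proof.
move=> [mf _] [mg _] fg.
have mNg : scalar_measurable (- g) by exact: scalar_measurableN.
have mNf : scalar_measurable (- f) by exact: scalar_measurableN.
apply/eqP; rewrite eq_le; apply/andP; split.
  have := L1normD (scalar_measurableD mf mNg) mg.
  by rewrite subrK (iffLR (ae_equalP mf mg) fg) add0e.
have := L1normD (scalar_measurableD mg mNf) mf.
by rewrite subrK (iffLR (ae_equalP mg mf) (ae_equal_sym fg)) add0e.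
Qed.

Lemma L1_normE f (fi : integrable_fun f) :
  L1_norm (L1_class fi) = of_real (fine (L1norm f)).
Proof.
congr (of_real (fine _)); apply: ae_equal_L1norm => //.
  exact: integrable_valP.
exact: L1_repr.
Qed.

Fact L1_addA : associative L1_add.
Proof.
move=> u v w; have [f [fi ->]] := L1_classP u.
have [g [gi ->]] := L1_classP v; have [h [hi ->]] := L1_classP w.
by rewrite !L1_addE; apply: L1_class_ext => x; rewrite addrA.
Qed.
Fact L1_addC : commutative L1_add.
Proof.
move=> u v; have [f [fi ->]] := L1_classP u; have [g [gi ->]] := L1_classP v.
by rewrite !L1_addE; apply: L1_class_ext => x; rewrite addrC.
Qed.
Fact L1_add0 : left_id L1_zero L1_add.
Proof.
move=> u; have [f [fi ->]] := L1_classP u.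
by rewrite !L1_addE; apply: L1_class_ext => x; exact: add0r.
Qed.
Fact L1_addN : left_inverse L1_zero L1_opp L1_add.
Proof.
move=> u; have [f [fi ->]] := L1_classP u.
by rewrite L1_oppE !L1_addE; apply: L1_class_ext => x; exact: addNr.
Qed.

HB.instance Definition _ :=
  GRing.isZmodule.Build L1 L1_addA L1_addC L1_add0 L1_addN.

Lemma L1_classD f g (fi : integrable_fun f) (gi : integrable_fun g) :
  L1_class fi + L1_class gi = L1_class (integrable_funD fi gi).
Proof. exact: L1_addE. Qed.

Lemma L1_classN f (fi : integrable_fun f) :
  - L1_class fi = L1_class (integrable_funN fi).
Proof. exact: L1_oppE. Qed.

Lemma L1_class0 : (0 : L1) = L1_class (integrable_fun0 X).
Proof. by []. Qed.

Fact L1_scaleA a b u : L1_scale a (L1_scale b u) = L1_scale (a * b) u.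
Proof.
have [f [fi ->]] := L1_classP u.
by rewrite !L1_scaleE; apply: L1_class_ext => x; exact: mulrA.
Qed.
Fact L1_scale1 : left_id 1 L1_scale.
Proof.
move=> u; have [f [fi ->]] := L1_classP u.
by rewrite !L1_scaleE; apply: L1_class_ext => x; exact: mul1r.
Qed.
Fact L1_scaleDr : right_distributive L1_scale +%R.
Proof.
move=> a u v; have [f [fi ->]] := L1_classP u.
have [g [gi ->]] := L1_classP v.
by rewrite L1_classD !L1_scaleE L1_classD; apply: L1_class_ext => x; exact: mulrDr.
Qed.
Fact L1_scaleDl u : {morph (fun a => L1_scale a u) : a b / a + b}.
Proof.
move=> a b; have [f [fi ->]] := L1_classP u.
by rewrite !L1_scaleE L1_classD; apply: L1_class_ext => x; exact: mulrDl.
Qed.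

HB.instance Definition _ := GRing.Zmodule_isLmodule.Build K L1
  L1_scaleA L1_scale1 L1_scaleDr L1_scaleDl.

Lemma L1_classZ c f (fi : integrable_fun f) :
  c *: L1_class fi = L1_class (integrable_funZ c fi).
Proof. exact: L1_scaleE. Qed.

Fact L1_normD u v : L1_norm (u + v) <= L1_norm u + L1_norm v.
Proof.
have [f [fi ->]] := L1_classP u; have [g [gi ->]] := L1_classP v.
have [mf _] := fi; have [mg _] := gi.
rewrite L1_classD !L1_normE -of_realD ler_of_real.
rewrite -fineD ?L1norm_fin//; apply: fine_le; last exact: L1normD.
  exact: L1norm_fin (integrable_funD _ _).
by rewrite fin_numD !L1norm_fin.
Qed.
Fact L1_normZ (c : K) u : L1_norm (c *: u) = `|c| * L1_norm u.
Proof.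
have [f [fi ->]] := L1_classP u; have [mf _] := fi.
rewrite L1_classZ !L1_normE L1normZ// fineM ?L1norm_fin//.
by rewrite of_realM normr_modulus.
Qed.
Fact L1_norm0_eq0 u : L1_norm u = 0 -> u = 0.
Proof.
have [f [fi ->]] := L1_classP u; rewrite L1_normE -of_real0 => /of_real_inj f0.
apply/L1_class_eq; have [mf _] := fi; have [m0 _] := integrable_fun0 (k := k) X.
apply/(ae_equalP mf m0).
have -> : f - (fun=> 0) = f by apply/funext => x; exact: subr0.
by rewrite -(fineK (L1norm_fin fi)) f0.
Qed.

HB.instance Definition _ := @Lmodule_isNormed.Build K L1 L1_norm
  L1_normD L1_normZ L1_norm0_eq0.

Lemma normr_L1_class f (fi : integrable_fun f) :
  `|L1_class fi| = of_real (fine (L1norm f)).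
Proof. exact: L1_normE. Qed.

Lemma normrB_L1_class f g (fi : integrable_fun f) (gi : integrable_fun g) :
  `|L1_class fi - L1_class gi| = of_real (fine (L1norm (f - g))).
Proof. by rewrite L1_classN L1_classD normr_L1_class. Qed.

Lemma scalar_gt0P (e : K) : 0 < e -> exists2 r : R, 0 < r & e = of_real r.
Proof.
move=> e0; exists (modulus e); last by rewrite -normr_modulus gtr0_norm.
by rewrite -(ltr_of_real k) of_real0 -normr_modulus normr_gt0 gt_eqF.
Qed.

Fact L1_complete (F : set_system L1) : ProperFilter F -> cauchy F -> cvg F.
Proof.
move=> FF /cauchyP Fc.
pose e n : R := 1 / 2 ^+ n.+1.
have e0 n : 0 < e n by rewrite divr_gt0// exprn_gt0.
have eK n : 0 < of_real (e n) :> K by rewrite -of_real0 ltr_of_real.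
have /choice[c cF] n : exists c, F (ball c (of_real (e n) : K)) by exact: Fc.
have FA n : F (\bigcap_(i in [set i | (i <= n)%N]) ball (c i) (of_real (e i) : K)).
  elim: n => [|n IH].
    apply: filterS (cF 0%N) => u u0 i /=; rewrite leqn0 => /eqP ->; exact: u0.
  apply: filterS (filterI IH (cF n.+1)) => u [un uS] i /=.
  by rewrite leq_eqVlt ltnS => /orP[/eqP ->//|]; exact: un.
have /choice[y yA] n : exists y : L1, forall i, (i <= n)%N ->
    ball (c i) (of_real (e i) : K) y.
  by have [u uA] := filter_ex (FA n); exists u => i ni; exact: uA.
have ee n : e n + e n = 1 / 2 ^+ n.
  by rewrite /e exprS; field; rewrite expf_neq0.
have yC n m : (n <= m)%N -> `|y m - y n| <= of_real (1 / 2 ^+ n).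
  move=> nm; rewrite -ee of_realD.
  have := yA m n nm; have := yA n n (leqnn n); rewrite -!ball_normE/= => h1 h2.
  rewrite -(subrK (c n) (y m)) -addrA; apply: le_trans (ler_normD _ _) _.
  by rewrite lerD// ltW// distrC.
pose f n : X -> K := repr (y n).
have fi n : integrable_fun (f n) by exact: integrable_valP.
have yE n : y n = L1_class (fi n).
  rewrite /L1_class -[LHS]reprK; congr (\pi_L1%qT _).
  rewrite /f; move: (fi n); rewrite /f; case: (repr (y n)) => h hi hi' /=.
  by congr IntegrableFun; exact: Prop_irrelevance.
have fiB n m : integrable_fun (f m - f n).
  by apply: integrable_funD => //; exact: integrable_funN.
have [n m nm|g gi fg] := @riesz_fischer _ _ _ f fi.
  have := yC n m nm; rewrite !yE normrB_L1_class ler_of_real => h.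
  by rewrite -(fineK (L1norm_fin (fiB n m))) lee_fin.
have yg n : `|y n - L1_class gi| <= of_real (1 / 2 ^+ n).
  rewrite yE normrB_L1_class ler_of_real.
  have fgi : integrable_fun (f n - g).
    by apply: integrable_funD => //; exact: integrable_funN.
  by rewrite -lee_fin fineK ?L1norm_fin.
apply/cvg_ex; exists (L1_class gi); apply/cvg_ballP => _/scalar_gt0P[r r0 ->].
have [n nr] : exists n, 2 / 2 ^+ n < r.
  have := @cvg_geometric R 2 2^-1; rewrite gtr0_norm// invf_lt1// ltr1n => /(_ isT).
  move=> /cvgr0Pnorm_lt/(_ _ r0)[n _ /(_ n (leqnn n)) h].
  by exists n; apply: le_lt_trans h; rewrite -exprVn; exact: ler_norm.
near=> u; rewrite -ball_normE/=.
have cu : ball (c n) (of_real (e n) : K) u by near: u; exact: cF.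
have := yA n n (leqnn n); move: cu; rewrite -!ball_normE/= => h1 h2.
have -> : L1_class gi - u = (L1_class gi - y n) + ((y n - c n) + (c n - u)).
  by rewrite (addrA (y n - c n)) subrK addrA subrK.
apply: le_lt_trans (ler_normD _ _) _.
apply: (@lt_trans _ _ (of_real (2 / 2 ^+ n))); last by rewrite ltr_of_real.
have -> : 2 / 2 ^+ n = 1 / 2 ^+ n + (e n + e n) :> R.
  by rewrite ee -mulrDl.
rewrite of_realD; apply: ler_ltD; first by rewrite distrC.
apply: le_lt_trans (ler_normD _ _) _.
by rewrite of_realD ltrD// distrC.
Unshelve. all: by end_near. Qed.

HB.instance Definition _ := Uniform_isComplete.Build L1 L1_complete.
End L1.

Section L1Functor.
Variables (R : realType) (k : base_field).
Local Notation K := (scalar R k).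
Local Notation ext f := (oapp f 0).
Implicit Types X Y Z : meas_space R.

(* (g \o s)^X for the partial map (A, s). *)
Definition zero_extension X Y (s : mp_partial X Y) (g : Y -> K) : X -> K :=
  fun x => oapp g 0 (s x).

Lemma ext_zero_extension X Y (s : mp_partial X Y) (g : Y -> K) z :
  ext (zero_extension s g) z = ext g (obind s z).
Proof. by case: z. Qed.

Lemma measurable_obind X Y (s : mp_partial X Y) :
  measurable_fun [set: adjoin X] (obind s : adjoin X -> adjoin Y).
Proof.
move=> _ A mA; rewrite setTI.
have [mT _] : msets (s @^-1` (Some @` [set: Y])) /\
    mu (s @^-1` (Some @` [set: Y])) = mu [set: Y].
  apply: partial_mapP; have : measurable [set: adjoin Y] by [].
  by rewrite /measurable/= /adjoin_measurable/= preimage_setT.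
have [ms _] := partial_mapP s (mA : msets (Some @^-1` A)).
pose P : set (adjoin X) := Some @` (s @^-1` (Some @` (Some @^-1` A))).
pose Q : set (adjoin X) := Some @` (s @^-1` (Some @` [set: Y])).
have mP : measurable P.
  by rewrite /measurable/= /adjoin_measurable/= some_preimage_image.
have mQ : measurable Q.
  by rewrite /measurable/= /adjoin_measurable/= some_preimage_image.
have mN : measurable ([set z : adjoin X | A None] : set (adjoin X)).
  have [AN|AN] := pselect (A None).
    by rewrite (_ : [set _ | _] = setT)//; apply/seteqP; split.
  by rewrite (_ : [set _ | _] = set0)//; apply/seteqP; split.
rewrite (_ : _ @^-1` A = P `|` (~` Q `&` [set z | A None])).
  by apply: measurableU => //; apply: measurableI => //; exact: measurableC.
apply/seteqP; split => [z /= Az|z /=].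
  case: z Az => [x|] /= Ax; last by right; split => // -[].
  case sx : (s x) Ax => [y|] /= Ay.
    by left; exists x => //=; exists y.
  by right; split => // -[x' + [xx]]; rewrite xx /= sx => -[].
move=> [[x /= [y Ay sy] <-] /=|[Qz AN]]; first by rewrite -sy.
case: z Qz => [x|]//= Qx; case sx : (s x) => [y|]//=.
by exfalso; apply: Qx; exists x => //=; exists y.
Qed.

Lemma scalar_measurable_zero_extension X Y (s : mp_partial X Y) (g : Y -> K) :
  scalar_measurable g -> scalar_measurable (zero_extension s g).
Proof.
move=> /scalar_measurableP[gr gi]; apply/scalar_measurableP; split.
  under eq_fun do rewrite ext_zero_extension.
  exact: (measurableT_comp gr (measurable_obind s)).
under eq_fun do rewrite ext_zero_extension.
exact: (measurableT_comp gi (measurable_obind s)).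
Qed.

Lemma L1norm_zero_extension X Y (s : mp_partial X Y) (g : Y -> K) :
  scalar_measurable g -> L1norm (zero_extension s g) = L1norm g.
Proof.
move=> mg.
pose D : set (adjoin Y) := Some @` setT.
have mD : measurable D.
  rewrite /measurable/= /adjoin_measurable/= some_preimage_image.
  have : measurable [set: adjoin Y] by [].
  by rewrite /measurable/= /adjoin_measurable/= preimage_setT.
have mm := scalar_measurable_modulus mg.
pose phi (w : adjoin Y) := (modulus (ext g w))%:E.
have Dphi w : ~ D w -> phi w = 0%E.
  by case: w => [y|] Dw; [exfalso; apply: Dw; exists y|rewrite /phi/= modulus0].
rewrite !L1normE; under eq_integral do rewrite ext_zero_extension.
transitivity (\int[adjoin_mu (X := X)]_(z in obind s @^-1` D) (phi \o obind s) z)%E.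
  rewrite [RHS]integral_mkcond; apply: eq_integral => z _.
  rewrite patchE; case: ifPn => // /negP Dz; rewrite -/(phi _) Dphi// => Ds.
  by apply: Dz; rewrite inE.
have mo := measurable_obind s.
rewrite -(ge0_integral_pushforward mo) //; last 2 first.
  by apply: measurable_funTS; exact/measurable_EFinP.
  by move=> y _; rewrite /phi lee_fin modulus_ge0.
transitivity (\int[adjoin_mu (X := Y)]_(w in D) phi w)%E.
  apply: eq_measure_integral => A mA AD.
  rewrite /pushforward /= /adjoin_mu.
  have [_ <-] := partial_mapP s (mA : msets (Some @^-1` A)).
  congr (mu _); apply/seteqP; split => x /=.
    case sx : (s x) => [y|] /= Ay; first by exists y.
    by have [] := AD _ Ay.
  by move=> [y Ay <-].
rewrite integral_mkcond; apply: eq_integral => w _.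
by rewrite patchE; case: ifPn => // /negP Dw; rewrite -/(phi _) Dphi// => Ds; apply: Dw; rewrite inE.
Qed.

Lemma integrable_zero_extension X Y (s : mp_partial X Y) (g : Y -> K) :
  integrable_fun g -> integrable_fun (zero_extension s g).
Proof.
move=> [mg gi]; split; first exact: scalar_measurable_zero_extension.
by rewrite -/(L1norm _) L1norm_zero_extension.
Qed.

Definition L1_map X Y (s : mp_partial X Y) (u : L1 k Y) : L1 k X :=
  L1_class (integrable_zero_extension s (integrable_valP (repr u))).

Lemma L1_mapE X Y (s : mp_partial X Y) g (gi : integrable_fun g) :
  L1_map s (L1_class gi) = L1_class (integrable_zero_extension s gi).
Proof.
apply/L1_class_eq; have [N [mN N0 h]] := L1_repr gi.
have [msN sN] := partial_mapP s mN.
exists (s @^-1` (Some @` N)); split; rewrite ?sN// => x /=.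
rewrite /zero_extension; case: (s x) => [y|]//= gy.
by exists y => //; exact: h.
Qed.

Program Definition L1_contraction X Y (s : mp_partial X Y) :
  contraction (L1 k Y) (L1 k X) := @Contraction R k (L1 k Y) (L1 k X) (L1_map s) _ _.
Next Obligation.
move=> X Y s a u v.
have [f [fi ->]] := L1_classP u; have [g [gi ->]] := L1_classP v.
rewrite L1_classZ L1_classD !L1_mapE L1_classZ L1_classD.
apply: L1_class_ext => x; rewrite /zero_extension /GRing.add/=.
by case: (s x) => //=; rewrite mulr0 addr0.
Qed.
Next Obligation.
move=> X Y s u; have [f [fi ->]] := L1_classP u; have [mf _] := fi.
by rewrite L1_mapE !normr_L1_class L1norm_zero_extension.
Qed.

Definition L1_functor : functor (opposite (Mea R)) (Ban R k).
refine (@Functor (opposite (Mea R)) (Ban R k) (fun X => L1 k X : completeNormedModType K)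
  (fun Y X s => L1_contraction s) _ _).
- move=> X; apply: contraction_ext => u /=; have [f [fi ->]] := L1_classP u.
  by rewrite L1_mapE; exact: L1_class_ext.
- move=> Z Y X s t; apply: contraction_ext => u /=.
  have [f [fi ->]] := L1_classP u; rewrite !L1_mapE; apply: L1_class_ext => x.
  by rewrite /zero_extension /=; case: (s x).
Defined.

Lemma L1norm1 X : L1norm (fun _ : X => 1 : K) = mu [set: X].
Proof.
pose D : set (adjoin X) := Some @` setT.
have mD : measurable D.
  rewrite /measurable/= /adjoin_measurable/= some_preimage_image.
  have : measurable [set: adjoin X] by [].
  by rewrite /measurable/= /adjoin_measurable/= preimage_setT.
rewrite L1normE.
transitivity (\int[adjoin_mu (X := X)]_(z in [set: adjoin X]) (\1_D z)%:E)%E.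
  apply: eq_integral => -[x|] _ /=.
    by rewrite modulus1 indicE mem_set//; exists x.
  by rewrite modulus0 indicE memNset// => -[].
rewrite integral_indic// setIT /=.
by rewrite /adjoin_mu some_preimage_image.
Qed.

Lemma integrable_fun1 X : integrable_fun (fun _ : X => 1 : K).
Proof.
split; last by rewrite -/(L1norm _) L1norm1 mu_finite.
have [m0 mC _] := msets_sigma_algebra X.
have mT : msets [set: X] by rewrite -(setD0 setT); exact: mC.
have cst_pre (c : R) (B : set R) : msets [set _ : X | B c].
  have [Bc|Bc] := pselect (B c).
    by rewrite (_ : [set _ | _] = setT)//; apply/seteqP; split.
  by rewrite (_ : [set _ | _] = set0)//; apply/seteqP; split.
by move=> B mB; split; exact: cst_pre.
Qed.

Definition L1_one X : L1 k X := L1_class (integrable_fun1 X).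

Definition L1_object : B_object R k.
refine (@BObject R k L1_functor L1_one _ _ _).
- move=> X Y Z i j [ij0 ijT].
  rewrite [X in X + _]L1_mapE [X in _ + X]L1_mapE [LHS]L1_classD.
  apply: L1_class_ext => x; rewrite /zero_extension /GRing.add/=.
  have : (range i `|` range j) x by rewrite ijT.
  have disj : ~ (range i x /\ range j x).
    by move=> [ix jx]; have : (range i `&` range j) x by []; rewrite ij0.
  case ix : (partial_inverse i x) => [y|]; case jx : (partial_inverse j x) => [z|] /=.
  + move: ix jx => /(partial_inverseP _ _ (@emb_inj _ _ _ i)) ix.
    move=> /(partial_inverseP _ _ (@emb_inj _ _ _ j)) jx.
    by exfalso; apply: disj; split; [exists y|exists z].
  + by rewrite addr0.
  + by rewrite add0r.
  + move=> [] [w _ wx].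
      by move/(partial_inverseP _ _ (@emb_inj _ _ _ i)) : wx; rewrite ix.
    by move/(partial_inverseP _ _ (@emb_inj _ _ _ j)) : wx; rewrite jx.
- by move=> X Y s; rewrite [LHS]L1_mapE; exact: L1_class_ext.
- by move=> X; rewrite normr_L1_class L1norm1.
Defined.

End L1Functor.

(* Main.v *)
Require Import Defs.
From mathcomp Require Import all_boot all_order all_algebra.
From mathcomp Require Import all_classical all_reals all_analysis.
From mathcomp Require Import measurable_realfun lra.

(* For an object (F, v), let w_A in F(X) be the image (Fi)(v_A) of the point v_A
   of a measurable subset A of X under its inclusion i.  By (I) and (II), w is a
   finitely additive vector measure on X, natural in X, and |w_A| <= mu(A) by
   (III).  Integrating step functions against w is therefore a contraction for
   the L^1 norm, so it extends by density to a contraction psi_X from L^1(X) to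
   F(X), characterized by
   |psi_X(u) - int s dw| <= |u - s| for every step function s.  Any map from
   (L^1, I) to (F, v) sends the indicator of A to w_A, hence is psi. *)

Set Implicit Arguments.
Unset Strict Implicit.
Unset Printing Implicit Defensive.

Import Order.TTheory GRing.Theory Num.Theory.
Import numFieldNormedType.Exports HBSimple.

Local Open Scope classical_set_scope.
Local Open Scope ring_scope.

(** * Measurable subsets as measure spaces, and restriction to them *)

Section MeasurableSubsets.
Variable R : realType.
Implicit Types X Y : meas_space R.

(** Transfers questions about [msets] to the measurable type [adjoin X], where the general lemmas on
    measurable sets and measures apply. *)
Lemma msetsE X (A : set X) : msets A <-> measurable (Some @` A : set (adjoin X)).
Proof.
by rewrite /measurable/= /adjoin_measurable/= some_preimage_image.
Qed.

Lemma adjoin_muE X (A : set X) : adjoin_mu (Some @` A) = mu A.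
Proof. by rewrite /adjoin_mu some_preimage_image. Qed.

Lemma msetsT X : msets [set: X].
Proof. by have [m0 mC _] := msets_sigma_algebra X; rewrite -(setD0 setT); exact: mC. Qed.

Lemma msetsC X (A : set X) : msets A -> msets (~` A).
Proof. by have [_ mC _] := msets_sigma_algebra X; rewrite -setTD; exact: mC. Qed.

Lemma msetsI X (A B : set X) : msets A -> msets B -> msets (A `&` B).
Proof.
move=> /msetsE mA /msetsE mB; have := measurableI _ _ mA mB.
by rewrite {1}/measurable/= /adjoin_measurable/= preimage_setI !some_preimage_image.
Qed.

Lemma le_mu X (A B : set X) : msets A -> msets B -> A `<=` B -> (mu A <= mu B)%E.
Proof.
move=> /msetsE mA /msetsE mB AB; rewrite -!adjoin_muE.
by apply: le_measure; rewrite ?inE//; exact: image_subset.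
Qed.

Record msubset X := MSubset {
  msubset_set :> set X;
  msubsetP : msets msubset_set }.

Lemma msubset_ext X (A B : msubset X) : A = B :> set X -> A = B.
Proof.
case: A B => [A mA] [B mB] /= AB; move: mA mB; rewrite AB => mA mB.
by congr MSubset; exact: Prop_irrelevance.
Qed.

Definition msubsetT X := MSubset (msetsT X).
Definition msubsetI X (A B : msubset X) := MSubset (msetsI (msubsetP A) (msubsetP B)).
Definition msubsetC X (A : msubset X) := MSubset (msetsC (msubsetP A)).
Definition msubset_preimage X Y (s : mp_partial X Y) (B : msubset Y) : msubset X :=
  MSubset (partial_mapP s (msubsetP B)).1.

Lemma sval_injective T (P : T -> Prop) : injective (@proj1_sig T P).
Proof.
move=> [x Px] [y Py] /= xy; move: Px Py; rewrite xy => Px Py.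
by congr exist; exact: Prop_irrelevance.
Qed.

Lemma image_sval T (A : set T) : @proj1_sig T A @` [set: _] = A.
Proof. by apply/seteqP; split => [_ [[x Ax] _ <-]//|x Ax]; exists (exist _ x Ax). Qed.

Program Definition subspace X (A : msubset X) : meas_space R :=
  @MeasSpace R {x : X | msubset_set A x} (fun B => msets (sval @` B))
    (fun B => mu (sval @` B)) _ _ _ _ _.
Next Obligation.
move=> X A; split => /=.
- by rewrite image_set0; have [] := msets_sigma_algebra X.
- move=> B mB.
  suff -> : sval @` (setT `\` B) = msubset_set A `&` ~` (sval @` B).
    by apply: msetsI; [exact: msubsetP|exact: msetsC].
  apply/seteqP; split => [_ [[x Ax] [_ nB] <-]|x [Ax nB]].
    by split => // -[y By] /sval_injective yx; apply: nB; rewrite -yx.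
  by exists (exist _ x Ax) => //; split => // Bx; apply: nB; exists (exist _ x Ax).
- move=> F mF; rewrite image_bigcup.
  by have [_ _] := msets_sigma_algebra X; apply.
Qed.
Next Obligation. by move=> X A /=; rewrite image_set0 mu_set0. Qed.
Next Obligation. by move=> X A B /=; exact: mu_ge0. Qed.
Next Obligation.
move=> X A F mF tF /=; rewrite image_bigcup; apply: mu_sigma_additive => //.
move=> i j _ _ [_ [[x Fx <-] [y Fy /sval_injective yx]]].
by apply: tF => //; exists x; split => //; rewrite -yx.
Qed.
Next Obligation.
move=> X A /=; rewrite image_sval; apply: le_lt_trans (mu_finite X).
by apply: le_mu => //; [exact: msubsetP|exact: msetsT].
Qed.

Definition inclusion X (A : msubset X) : embedding (subspace A) X :=
  @Embedding R (subspace A) X sval (@sval_injective _ _)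
    (fun=> conj id id) (fun _ _ => erefl).

Definition restriction X (A : msubset X) : mp_partial X (subspace A) :=
  mp_embedding (inclusion A).

Lemma restriction_sval X (A : msubset X) (y : subspace A) :
  restriction A (sval y) = Some y.
Proof. exact/(partial_inverseP _ _ (@emb_inj _ _ _ (inclusion A))). Qed.

Lemma restriction_Some X (A : msubset X) (x : X) (y : subspace A) :
  restriction A x = Some y -> sval y = x.
Proof. by move/(partial_inverseP _ _ (@emb_inj _ _ _ (inclusion A))). Qed.

Lemma restriction_None X (A : msubset X) (x : X) :
  ~ msubset_set A x -> restriction A x = None.
Proof.
move=> Ax; case E : (restriction A x) => [[y Ay]|//].
by case: Ax; move/restriction_Some : E => /= <-.
Qed.

Lemma zero_extension_restriction (k : base_field) X (A : msubset X) (x : X) :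
  zero_extension (restriction A) (fun=> 1 : Defs.scalar R k) x =
  (x \in (A : set X))%:R.
Proof.
rewrite /zero_extension; have [Ax|Ax] := pselect (msubset_set A x).
  by rewrite mem_set// (restriction_sval (A := A) (exist _ x Ax)).
by rewrite memNset// restriction_None.
Qed.

Lemma mp_compE X Y Z (t : mp_partial Y Z) (s : mp_partial X Y) x :
  mp_comp t s x = obind t (s x).
Proof. by []. Qed.

End MeasurableSubsets.

(** * The vector measure attached to an object of [B] *)

Section VectorMeasure.
Variables (R : realType) (k : base_field).
Implicit Types X Y Z : meas_space R.
Local Notation presheaf := (functor (opposite (Mea R)) (Ban R k)).

Lemma pullback_comp (F : presheaf) X Y Z (t : mp_partial Y Z) (s : mp_partial X Y) w :
  pullback F (mp_comp t s) w = pullback F s (pullback F t w).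
Proof.
exact: (congr1 (fun h : Defs.contraction _ _ => h w) (@Defs.fmap_comp _ _ F Z Y X s t)).
Qed.

Variable F : B_object R k.
Local Notation pull := (pullback (B_functor F)).

Definition vmeasure X (A : msubset X) : value (B_functor F) X :=
  pull (restriction A) (B_point F (subspace A)).

(** As [s] is option-valued, its value at a point of the preimage of [B] is extracted from the
    membership proof. The outcome is a total map between subspaces, to which (II) applies. *)
Definition mp_corestrict_fun X Y (s : mp_partial X Y) (B : msubset Y)
  (x : subspace (msubset_preimage s B)) : subspace B :=
  let: exist2 y By _ := cid2 (proj2_sig x) in exist _ y By.

Lemma mp_corestrict_funE X Y (s : mp_partial X Y) (B : msubset Y)
  (x : subspace (msubset_preimage s B)) : s (sval x) = Some (sval (mp_corestrict_fun x)).
Proof. by rewrite /mp_corestrict_fun; case: cid2. Qed.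

Program Definition mp_corestrict X Y (s : mp_partial X Y) (B : msubset Y) :
  mp_map (subspace (msubset_preimage s B)) (subspace B) :=
  MpMap (total_map := @mp_corestrict_fun X Y s B) _.
Next Obligation.
move=> X Y s B C mC /=.
have [msC sC] := partial_mapP s (mC : msets (sval @` C : set Y)).
suff -> : sval @` (@mp_corestrict_fun X Y s B @^-1` C) =
    s @^-1` (Some @` (sval @` C)) by [].
apply/seteqP; split => [_ [x Cx <-]|x] /=.
  rewrite mp_corestrict_funE; exists (sval (mp_corestrict_fun x)) => //.
  by exists (mp_corestrict_fun x).
move=> [_ [[y By] Cy <-] /= sx].
have Px : msubset_set (msubset_preimage s B) x by exists y.
exists (exist _ x Px) => //=.
suff -> : mp_corestrict_fun (exist _ x Px) = exist _ y By by [].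
apply: sval_injective; apply: Some_inj.
by rewrite -mp_corestrict_funE/= -sx.
Qed.

(** Applying [s] and then restricting to [B] is the same partial map as restricting to the preimage
    of [B] and then applying the corestriction of [s]. By (II) the corestriction pulls the point at
    [B] back to the point at its preimage. *)
Lemma pullback_vmeasure X Y (s : mp_partial X Y) (B : msubset Y) :
  pull s (vmeasure B) = vmeasure (msubset_preimage s B).
Proof.
rewrite /vmeasure -(B_invariant F (mp_corestrict s B)) -!pullback_comp.
congr (pull _ _); apply: mp_partial_ext => x; rewrite !mp_compE.
have [[y By sx]|nB] := pselect (msubset_set (msubset_preimage s B) x); last first.
  rewrite (restriction_None nB); case sx : (s x) => [y|]//=.
  by apply: restriction_None => By; apply: nB; exists y.
have Px : msubset_set (msubset_preimage s B) x by exists y.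
rewrite (restriction_sval (A := msubset_preimage s B) (exist _ x Px)) -sx; cbn [Option.bind].
have -> : y = sval (mp_corestrict_fun (exist _ x Px)).
  by apply: Some_inj; rewrite -mp_corestrict_funE.
exact: restriction_sval.
Qed.

(** [X] and its full subspace are different types, so the points of [F] at the two are compared
    through (II). *)
Program Definition to_subspaceT X : mp_map X (subspace (msubsetT X)) :=
  MpMap (total_map := fun x => exist _ x I) _.
Next Obligation.
move=> X C mC.
suff -> : (fun x : X => exist _ x I) @^-1` C = sval @` C by [].
apply/seteqP; split => [x Cx|_ [[x []] Cx <-]]; last by [].
by exists (exist _ x I).
Qed.

Lemma vmeasureT X : vmeasure (msubsetT X) = B_point F X.
Proof.
rewrite -(B_invariant F (to_subspaceT X)); congr (pull _ _).
apply: mp_partial_ext => x.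
exact: (restriction_sval (A := msubsetT X) (exist _ x I)).
Qed.

Lemma pullbackD X Y (s : mp_partial X Y) : {morph pull s : u w / u + w}.
Proof.
by move=> u w; rewrite -[u in LHS]scale1r contr_linear scale1r.
Qed.

Lemma vmeasure_complement X (A B : msubset X) : A `&` B = set0 ->
  A `|` B = setT -> vmeasure A + vmeasure B = B_point F X.
Proof.
by move=> AB ABT; apply: B_additive; split; rewrite !image_sval.
Qed.

(** Axiom (I) splits a whole space only. It is applied inside the subspace [C], and the identity
    obtained there is pulled back along the restriction to [C]. *)
Lemma vmeasureD X (A B C : msubset X) : A `&` B = set0 ->
  A `|` B = C -> vmeasure A + vmeasure B = vmeasure C.
Proof.
move=> AB ABC.
have trace_msets (D : msubset X) : D `<=` C ->
    exists D' : msubset (subspace C), D' = @proj1_sig X (msubset_set C) @^-1` D :> set _ /\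
      msubset_preimage (restriction C) D' = D.
  move=> DC.
  have DE : @proj1_sig X (msubset_set C) @` (@proj1_sig X (msubset_set C) @^-1` D) = D.
    apply/seteqP; split => [_ [x Dx <-]//|x Dx].
    by exists (exist _ x (DC x Dx)).
  have mD : @msets R (subspace C) (@proj1_sig X (msubset_set C) @^-1` D).
    by rewrite /= DE; exact: msubsetP.
  exists (MSubset mD); split => //; apply: msubset_ext => /=; rewrite -[RHS]DE.
  apply/seteqP; split => [x [y Dy /esym]|_ [y Dy <-]]; last first.
    by exists y => //; exact/esym/(restriction_sval y).
  move/restriction_Some => <-.
  by exists y.
have AC : A `<=` C by rewrite -ABC; exact: subsetUl.
have BC : B `<=` C by rewrite -ABC; exact: subsetUr.
have [A' [A'E <-]] := trace_msets A AC.
have [B' [B'E <-]] := trace_msets B BC.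
rewrite -!pullback_vmeasure -pullbackD vmeasure_complement//.
  by rewrite A'E B'E -preimage_setI AB preimage_set0.
rewrite A'E B'E -preimage_setU ABC.
by apply/seteqP; split => // -[].
Qed.

Lemma norm_vmeasure X (A : msubset X) : `|vmeasure A| <= of_real (fine (mu A)).
Proof.
apply: le_trans (contr_norm _ _) _.
by have := B_bounded F (subspace A); rewrite /= image_sval.
Qed.

End VectorMeasure.

(** * Step functions and the norm bound for their integrals *)

Section StepIntegral.
Variables (R : realType) (k : base_field).
Local Notation K := (Defs.scalar R k).

(* A step function is encoded by the list of its coefficients and sets, with no
   disjointness requirement.  Its value at x is its integral against the Dirac
   mass at x, and its class in L^1 is its integral against the vector measure
   that (L^1, I) itself defines. *)
Definition step_integral (X : meas_space R) (W : lmodType K) (v : msubset X -> W)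
  (s : seq (K * msubset X)) : W := \sum_(p <- s) p.1 *: v p.2.

Section Lmodule.
Variables (X : meas_space R) (W : lmodType K) (v : msubset X -> W).
Implicit Types (s t : seq (K * msubset X)) (A E : msubset X).

Lemma step_integral_cons p s :
  step_integral v (p :: s) = p.1 *: v p.2 + step_integral v s.
Proof. by rewrite /step_integral big_cons. Qed.

Lemma step_integral_cat s t :
  step_integral v (s ++ t) = step_integral v s + step_integral v t.
Proof. by rewrite /step_integral big_cat. Qed.

Lemma step_integralZ c s :
  step_integral v [seq (c * p.1, p.2) | p <- s] = c *: step_integral v s.
Proof.
rewrite /step_integral big_map scaler_sumr.
by apply: eq_bigr => p _; rewrite scalerA.
Qed.

Definition trace E s := [seq (p.1, msubsetI E p.2) | p <- s].

Lemma step_integral_traceT s : step_integral v (trace (msubsetT X) s) = step_integral v s.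
Proof.
rewrite /step_integral big_map; apply: eq_bigr => p _ /=; congr (_ *: v _).
by apply: msubset_ext; rewrite /= setTI.
Qed.

Definition finitely_additive := forall A B C : msubset X,
  A `&` B = set0 -> A `|` B = C -> v A + v B = v C.

Hypothesis vD : finitely_additive.

Lemma additive_split E A : v E = v (msubsetI E A) + v (msubsetI E (msubsetC A)).
Proof.
by rewrite (vD (C := E))//= -?setIUr ?setUv ?setIT// setIACA setICr setI0.
Qed.

Lemma step_integral_split E A s :
  step_integral v (trace E s) = step_integral v (trace (msubsetI E A) s) +
    step_integral v (trace (msubsetI E (msubsetC A)) s).
Proof.
rewrite /step_integral !big_map -big_split; apply: eq_bigr => p _ /=.
rewrite -scalerDr (additive_split (msubsetI E p.2) A); congr (_ *: (v _ + v _));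
  by apply: msubset_ext; rewrite /= setIAC.
Qed.

(** Inside [A] the coefficient [a] merges with [c]; outside [A] it contributes nothing. Both halves
    have the shape of the left-hand side with a list shorter by one, as an induction requires. *)
Lemma step_integral_cons_split c E a A s :
  step_integral v ((c, E) :: trace E ((a, A) :: s)) =
  step_integral v ((c + a, msubsetI E A) :: trace (msubsetI E A) s) +
  step_integral v ((c, msubsetI E (msubsetC A)) :: trace (msubsetI E (msubsetC A)) s).
Proof.
rewrite /= !step_integral_cons/= (step_integral_split E A s) (additive_split E A).
by rewrite scalerDr scalerDl (addrA (a *: _)) addrACA -!addrA.
Qed.

End Lmodule.

Definition dirac_mass (X : meas_space R) (x : X) (A : msubset X) : K^o :=
  (x \in (A : set X))%:R.

Definition step (X : meas_space R) (s : seq (K * msubset X)) (x : X) : K :=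
  step_integral (dirac_mass x) s.

Section L1Step.
Variable X : meas_space R.
Implicit Types (s t : seq (K * msubset X)) (A E : msubset X).
Local Notation chi := (@vmeasure R k (L1_object R k) X).

(** Shows that such a function vanishes off [E], so that the two halves of a split have disjoint
    supports. *)
Lemma step_traceE E c s x :
  step ((c, E) :: trace E s) x = (c + step s x) * (x \in (E : set X))%:R.
Proof.
rewrite /step step_integral_cons mulrDl; congr (_ + _).
rewrite /step_integral big_map mulr_suml; apply: eq_bigr => p _ /=.
rewrite /dirac_mass in_setI andbC -mulnb natrM; exact: mulrA.
Qed.

Lemma integrable_fun_indic A : integrable_fun (fun x => (x \in (A : set X))%:R : K).
Proof.
rewrite -(funext (zero_extension_restriction k A)).
exact: integrable_zero_extension (integrable_fun1 k (subspace A)).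
Qed.

Lemma chiE A : chi A = L1_class (integrable_fun_indic A).
Proof.
rewrite [LHS]L1_mapE; apply: L1_class_ext => x.
exact: zero_extension_restriction.
Qed.

(** For the object of L^1 the bound [norm_vmeasure] is an equality; this is the base case of the
    comparison with [F]. *)
Lemma norm_chi A : `|chi A| = of_real (fine (mu A)).
Proof.
rewrite [X in `|X|]L1_mapE normr_L1_class L1norm_zero_extension ?L1norm1/= ?image_sval//.
by have [] := integrable_fun1 k (subspace A).
Qed.

Lemma integrable_step s : integrable_fun (step s).
Proof.
elim: s => [|[c A] s IH].
  rewrite (_ : step [::] = fun=> 0); first exact: integrable_fun0.
  by apply/funext => x; rewrite /step /step_integral big_nil.
have -> : step ((c, A) :: s) = (fun x => c * (x \in (A : set X))%:R) + step s.
  by apply/funext => x; rewrite /step step_integral_cons.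
exact: integrable_funD (integrable_funZ _ (integrable_fun_indic A)) IH.
Qed.

Lemma step_integral_chi s : step_integral chi s = L1_class (integrable_step s).
Proof.
elim: s => [|[c A] s IH].
  rewrite /step_integral big_nil L1_class0; apply: L1_class_ext => x.
  by rewrite /step /step_integral big_nil.
rewrite step_integral_cons IH /= chiE L1_classZ L1_classD.
by apply: L1_class_ext => x; rewrite /step step_integral_cons.
Qed.

(** At each point one summand is zero, so the triangle inequality for the modulus is an equality
    there. *)
Lemma L1norm_disjoint (f g : X -> K) : scalar_measurable f -> scalar_measurable g ->
  (forall x, f x = 0 \/ g x = 0) -> L1norm (f + g) = (L1norm f + L1norm g)%E.
Proof.
move=> /scalar_measurable_modulus mf /scalar_measurable_modulus mg fg0.
rewrite !L1normE -ge0_integralD//=.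
- apply: eq_integral => z _; rewrite extD.
  case: z => [x|] /=; last by rewrite addr0 modulus0 add0e.
  by case: (fg0 x) => ->; rewrite ?add0r ?addr0 modulus0 ?add0e ?adde0.
- by move=> z _; rewrite lee_fin modulus_ge0.
- exact/measurable_EFinP.
- by move=> z _; rewrite lee_fin modulus_ge0.
- exact/measurable_EFinP.
Qed.

Lemma normrD_disjoint (f g : X -> K) (fi : integrable_fun f) (gi : integrable_fun g) :
  (forall x, f x = 0 \/ g x = 0) ->
  `|L1_class fi + L1_class gi| = `|L1_class fi| + `|L1_class gi|.
Proof.
move=> fg0; have [mf _] := fi; have [mg _] := gi.
by rewrite L1_classD !normr_L1_class L1norm_disjoint// fineD ?L1norm_fin// of_realD.
Qed.

End L1Step.

Variable F : B_object R k.

(* The statement carries an extra term c on a set E so that the induction can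
   split E along the first set A of the list, absorbing its coefficient a in c
   on the part of E inside A. *)
Lemma norm_step_integral_trace X (s : seq (K * msubset X)) c E :
  `|step_integral (@vmeasure _ _ F X) ((c, E) :: trace E s)| <=
  `|step_integral (@vmeasure _ _ (L1_object R k) X) ((c, E) :: trace E s)|.
Proof.
elim: s c E => [|[a A] s IH] c E.
  rewrite !step_integral_cons /step_integral !big_nil !addr0.
  rewrite [leLHS]normrZ [leRHS]normrZ ler_wpM2l//=.
  by apply: le_trans (norm_vmeasure _ _) _; rewrite -norm_chi.
rewrite !step_integral_cons_split; try exact: vmeasureD.
(* In [F] the halves are only bounded by the triangle inequality, but in L^1 their norms add up
   exactly, because their supports are disjoint. *)
apply: le_trans (ler_normD _ _) _; apply: le_trans (lerD (IH _ _) (IH _ _)) _.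
rewrite !step_integral_chi normrD_disjoint// => x; rewrite !step_traceE /=.
rewrite !in_setI in_setC.
by case: (x \in msubset_set A); rewrite ?andbF mulr0; [right|left].
Qed.

(** Makes the integral against [F] depend only on the L^1 class of a step function, whichever list
    represents it, and contractively so. *)
Lemma norm_step_integral X (s : seq (K * msubset X)) :
  `|step_integral (@vmeasure _ _ F X) s| <=
  `|step_integral (@vmeasure _ _ (L1_object R k) X) s|.
Proof.
have := norm_step_integral_trace s 0 (msubsetT X).
by rewrite !step_integral_cons !scale0r !add0r !step_integral_traceT.
Qed.

End StepIntegral.

(** * Density of step functions in L^1 *)

Section Density.
Variables (R : realType) (k : base_field) (X : meas_space R).
Local Notation K := (Defs.scalar R k).
Local Notation Re := (@scalar_Re R k).
Local Notation Im := (@scalar_Im R k).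
Local Notation mX := (adjoin_mu (X := X)).
Local Notation chi := (@vmeasure R k (L1_object R k) X).
Implicit Types (s : seq (K * msubset X)) (f : X -> K).

Lemma step_sfun (g : {sfun adjoin X >-> R}) :
  exists s, forall x, step s x = of_real (g (Some x)).
Proof.
have mg (y : R) : msets (Some @^-1` (g @^-1` [set y])).
  have := measurable_funPTI g (measurable_set1 y); exact.
(* One term for each of the finitely many values of [g], supported on the fibre over that value with
   the extra point removed. *)
exists [seq (of_real y, MSubset (mg y)) | y <- finmap.enum_fset (fset_set (range g))] => x.
rewrite fimfunE fsbig_finite//= (big_morph _ (@of_realD R k) (of_real0 R k)).
rewrite /step /step_integral big_map; apply: eq_bigr => y _.
rewrite of_realM /dirac_mass indicE; congr (_ * _).
rewrite -[x \in _]/(Some x \in g @^-1` [set y]).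
by case: (_ \in _); rewrite ?of_real1 ?of_real0.
Qed.

Lemma sfun_dense_integrable (h : adjoin X -> R) (e : R) :
  mX.-integrable [set: adjoin X] (EFin \o h) -> 0 < e ->
  exists g : {sfun adjoin X >-> R},
    (\int[mX]_(z in [set: adjoin X]) `|h z - g z|%:E < e%:E)%E.
Proof.
move=> ih e0; have [g [_ _ gh]] := approximation_sfun_integrable measurableT ih.
have e0' : nbhs 0%E [set y | (y < e%:E)%E].
  by apply: open_nbhs_nbhs; split; [exact: open_ereal_lt_ereal|rewrite /= lte_fin].
have [n _ /(_ n (leqnn n)) hn] := gh _ e0'.
by exists (g n).
Qed.

(** [scalar_mk k 0 1] is the imaginary unit over the complex numbers and 0 over the reals, so one
    formula serves both fields. *)
Lemma modulus_subr_le (z : K) (a b : R) :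
  modulus (z - (of_real a + scalar_mk k 0 1 * of_real b)) <= `|Re z - a| + `|Im z - b|.
Proof.
apply: le_trans (modulus_le _) _.
rewrite !(scalar_ReD, scalar_ImD, scalar_ReN, scalar_ImN, scalar_ReM, scalar_ImM).
rewrite !scalar_Re_of_real !scalar_Im_of_real scalar_mk_Re mulr0 mul0r subr0 addr0.
rewrite lerD2l add0r mulr0 add0r; case: k z => [z|z] /=.
  by rewrite mul0r subr0 normr0.
by rewrite mul1r.
Qed.

Lemma step_dense f (e : R) : integrable_fun f -> 0 < e ->
  exists s, (L1norm (f - step s)%R < e%:E)%E.
Proof.
move=> [mf fi] e0; have /scalar_measurableP[mr mi] := mf.
(* Real and imaginary parts are integrable because the modulus dominates them; each is then
   approximated within [e / 2]. *)
have dom (h : K -> R) : (forall z, `|h z| <= modulus z) ->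
    measurable_fun [set: adjoin X] (fun z : adjoin X => h (oapp f 0 z)) ->
    mX.-integrable [set: adjoin X] (EFin \o (fun z : adjoin X => h (oapp f 0 z))).
  move=> hm mh; apply/integrableP; split; first exact/measurable_EFinP.
  apply: le_lt_trans fi; rewrite -/(L1norm f) L1normE.
  apply: ge0_le_integral => //=.
  - by apply/measurable_EFinP; exact: measurableT_comp.
  - exact/measurable_EFinP/scalar_measurable_modulus.
  - by move=> z _; rewrite lee_fin.
have e20 : 0 < e / 2 by rewrite divr_gt0.
have [gr grP] := sfun_dense_integrable (dom _ (@Re_le_modulus R k) mr) e20.
have [gi giP] := sfun_dense_integrable (dom _ (@Im_le_modulus R k) mi) e20.
have [sr srE] := step_sfun gr; have [si siE] := step_sfun gi.
pose s := sr ++ [seq (scalar_mk k 0 1 * p.1, p.2) | p <- si].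
have sE x : step s x = of_real (gr (Some x)) + scalar_mk k 0 1 * of_real (gi (Some x)).
  by rewrite -srE -siE /step step_integral_cat step_integralZ.
exists s; rewrite L1normE [e]splitr EFinD.
have mB (h : K -> R) (g : {sfun adjoin X >-> R}) :
    measurable_fun [set: adjoin X] (fun z : adjoin X => h (oapp f 0 z)) ->
    measurable_fun [set: adjoin X] (fun z : adjoin X => `|h (oapp f 0 z) - g z|%:E).
  move=> mh; apply/measurable_EFinP; apply: measurableT_comp => //.
  by apply: measurable_funB.
apply: le_lt_trans (lteD grP giP); rewrite -ge0_integralD//; last 2 first.
  exact: mB.
  exact: mB.
apply: ge0_le_integral => //=.
- by move=> z _; rewrite lee_fin modulus_ge0.
- apply/measurable_EFinP/scalar_measurable_modulus/scalar_measurableD => //.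
  by apply: scalar_measurableN; have [] := integrable_step s.
- by apply: emeasurable_funD; exact: mB.
(* At [None] the left integrand is 0, whatever values [gr] and [gi] take there. *)
- case=> [x|] _ /=; rewrite lee_fin; last by rewrite modulus0 addr_ge0.
  by rewrite [(f - step s) x]/(f x - step s x) sE modulus_subr_le.
Qed.

End Density.

(** * Extension of the integral from step functions to L^1 *)

Section Extension.
Variables (R : realType) (k : base_field).
Local Notation K := (Defs.scalar R k).
Implicit Types X Y : meas_space R.
Local Notation chi := (step_integral (@vmeasure R k (L1_object R k) _)).

Lemma step_dense_L1 X (u : L1 k X) (e : K) : 0 < e -> exists s, `|u - chi s| < e.
Proof.
move=> /scalar_gt0P[r r0 ->]; have [f [fi ->]] := L1_classP u.
have [s fs] := step_dense fi r0; exists s.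
rewrite step_integral_chi normrB_L1_class ltr_of_real -lte_fin fineK//.
exact/L1norm_fin/integrable_funD/integrable_funN/integrable_step.
Qed.

Variable F : B_object R k.
Local Notation int := (step_integral (@vmeasure R k F _)).

Lemma step_integralB X (W : lmodType K) (v : msubset X -> W) s t :
  step_integral v s - step_integral v t =
  step_integral v (s ++ [seq (-1 * p.1, p.2) | p <- t]).
Proof. by rewrite step_integral_cat step_integralZ scaleN1r. Qed.

Lemma dist_step_integral X (s t : seq (K * msubset X)) :
  `|int s - int t| <= `|chi s - chi t|.
Proof. rewrite !step_integralB; exact: norm_step_integral. Qed.

Lemma ball_dist (V : normedModType K) (u v w : V) (e : K) :
  `|u - v| < e -> `|u - w| < e -> `|v - w| <= e + e.
Proof.
move=> uv uw; rewrite -(subrK u v) -addrA; apply: le_trans (ler_normD _ _) _.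
by rewrite lerD// ltW// distrC.
Qed.

(** The integrals of step functions near [u] form a Cauchy filter by [dist_step_integral], and [w]
    is its limit. The bound passes to the limit from the same bound between step functions. *)
Lemma step_integral_cvg X (u : L1 k X) :
  exists w : value (B_functor F) X, forall s, `|w - int s| <= `|u - chi s|.
Proof.
pose G : set_system (value (B_functor F) X) := [set A |
  exists2 d : R, 0 < d & forall s, `|u - chi s| < of_real d -> A (int s)].
have eK (e : R) : 0 < e -> 0 < of_real e :> K by rewrite -(ltr_of_real k) of_real0.
have GF : ProperFilter G.
  apply: Build_ProperFilter.
    (* Properness of the filter is the density of step functions. *)
    by move=> [d /eK d0 dG]; have [s us] := step_dense_L1 u d0; exact: dG us.
  split; first by exists 1.
    move=> P Q [d d0 dP] [e e0 eQ]; exists (Num.min d e); rewrite ?lt_min ?d0//.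
    move=> s us; split; [apply: dP|apply: eQ]; apply: lt_le_trans us _;
      by rewrite ler_of_real ge_min lexx ?orbT.
  by move=> P Q PQ [d d0 dP]; exists d => // s /dP/PQ.
have Gc : cauchy G.
  apply/cauchyP => _/scalar_gt0P[r r0 ->].
  (* Two integrals in the filter set for [r / 4] are at distance at most [r / 2], which is strictly
     below [r]. *)
  have r40 : 0 < r / 4 by rewrite divr_gt0.
  have [t ut] := step_dense_L1 u (eK _ r40).
  exists (int t); exists (r / 4) => // s us; rewrite -ball_normE/=.
  apply: le_lt_trans (dist_step_integral _ _) _.
  apply: le_lt_trans (ball_dist ut us) _.
  rewrite -of_realD ltr_of_real; lra.
have [w Gw] := iffLR (cvg_ex G) (iffLR (cauchy_cvgP G) Gc).
exists w => s; apply/ler_addgt0Pr => _/scalar_gt0P[r r0 ->].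
have r20 : 0 < r / 2 by rewrite divr_gt0.
have [d d0 dG] := Gw _ (nbhsx_ballx w _ (eK _ r20)).
(* The bound [d] puts the integral of [t] within [r / 2] of [w]; the other bound keeps [t] within
   [r / 2] of [u]. The two errors add up to [r]. *)
have md0 : 0 < Num.min d (r / 2) by rewrite lt_min d0.
have [t ut] := step_dense_L1 u (eK _ md0).
have wt : `|w - int t| < of_real (r / 2).
  have := dG t; rewrite -ball_normE/=; apply; apply: lt_le_trans ut _.
  by rewrite ler_of_real ge_min lexx.
have ut' : `|u - chi t| <= of_real (r / 2).
  by apply/ltW/(lt_le_trans ut); rewrite ler_of_real ge_min lexx orbT.
have ts : `|int t - int s| <= of_real (r / 2) + `|u - chi s|.
  apply: le_trans (dist_step_integral _ _) _.
  rewrite -(subrK u (chi t)) -addrA; apply: le_trans (ler_normD _ _) _.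
  by rewrite lerD// distrC.
rewrite -(subrK (int t) w) -addrA; apply: le_trans (ler_normD _ _) _.
apply: le_trans (lerD (ltW wt) ts) _.
by rewrite addrA -of_realD -splitr addrC.
Qed.

Definition L1_integral X (u : L1 k X) : value (B_functor F) X :=
  projT1 (cid (step_integral_cvg u)).

Lemma L1_integralP X (u : L1 k X) s : `|L1_integral u - int s| <= `|u - chi s|.
Proof. by rewrite /L1_integral; case: cid. Qed.

(** Reduces linearity, naturality and uniqueness to step functions: it suffices that one list
    approximates [u] in L^1 and [w] in [F] at the same time. *)
Lemma L1_integral_unique X (u : L1 k X) (w : value (B_functor F) X) :
  (forall e : K, 0 < e -> exists s, `|u - chi s| < e /\ `|w - int s| <= e) ->
  w = L1_integral u.
Proof.
move=> uw; apply/eqP; rewrite -subr_eq0 -normr_le0; apply/ler_addgt0Pr => e e0.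
have e20 : 0 < e / 2 by rewrite divr_gt0.
have [s [us ws]] := uw _ e20.
rewrite -(subrK (int s) w) -addrA add0r [e]splitr; apply: le_trans (ler_normD _ _) _.
rewrite lerD// distrC; exact: le_trans (L1_integralP u s) (ltW us).
Qed.

Lemma L1_integral_linear X : linear (@L1_integral X).
Proof.
move=> a u v; apply/esym/L1_integral_unique => e e0.
have c0 : 0 < `|a| + 1 by rewrite ltr_wpDl.
(* With this tolerance [d] the total error is [|a| * d + d = e]; adding 1 keeps the denominator
   positive when [a] is 0. *)
have d0 : 0 < e / (`|a| + 1) by rewrite divr_gt0.
have [s us] := step_dense_L1 u d0.
have [t vt] := step_dense_L1 v d0.
(* Stated for any [V], as it is used once in L^1 and once in the values of [F]. *)
have approx (V : normedModType K) (x y x' y' : V) :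
    `|x - x'| <= `|u - chi s| -> `|y - y'| <= `|v - chi t| ->
    `|a *: x + y - (a *: x' + y')| < e.
  move=> xs yt; rewrite opprD addrACA -scalerBr.
  apply: le_lt_trans (ler_normD _ _) _; rewrite normrZ.
  have -> : e = `|a| * (e / (`|a| + 1)) + e / (`|a| + 1).
    by rewrite -[X in _ + X]mul1r -mulrDl mulrC divfK// gt_eqF.
  apply: ler_ltD; last exact: le_lt_trans vt.
  by rewrite ler_wpM2l// ltW// (le_lt_trans xs).
exists ([seq (a * p.1, p.2) | p <- s] ++ t).
rewrite !step_integral_cat !step_integralZ; split; first exact: approx.
by apply/ltW/approx; exact: L1_integralP.
Qed.

Lemma L1_integral_norm X (u : L1 k X) : `|L1_integral u| <= `|u|.
Proof.
(* The empty list represents the zero function. *)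
by have := L1_integralP u [::]; rewrite /step_integral !big_nil !subr0.
Qed.

Definition L1_integral_contraction X :
  Defs.contraction (value (B_functor (L1_object R k)) X) (value (B_functor F) X) :=
  @Contraction R k _ _ _ (@L1_integral_linear X) (@L1_integral_norm X).

End Extension.

(** * Naturality of the integral and uniqueness of the map out of L^1 *)

Section Contractions.
Variables (R : realType) (k : base_field).
Local Notation K := (Defs.scalar R k).
Variables (V W : completeNormedModType K) (h : Defs.contraction V W).

Lemma contr0 : h 0 = 0.
Proof.
by have := contr_linear h (-1) 0 0; rewrite scaler0 addr0 scaleN1r addNr.
Qed.

Lemma contrB : {morph h : x y / x - y}.
Proof. by move=> x y; rewrite addrC -scaleN1r contr_linear scaleN1r addrC. Qed.

Lemma contr_step_integral (X : meas_space R) (v : msubset X -> V) s :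
  h (step_integral v s) = step_integral (h \o v) s.
Proof.
elim: s => [|p s IH]; first by rewrite /step_integral !big_nil contr0.
by rewrite !step_integral_cons contr_linear IH.
Qed.

End Contractions.

Section Initiality.
Variables (R : realType) (k : base_field) (F : B_object R k).
Local Notation K := (Defs.scalar R k).
Implicit Types X Y : meas_space R.

Lemma pullback_step_integral (G : B_object R k) X Y (s : mp_partial X Y) t :
  pullback (B_functor G) s (step_integral (@vmeasure R k G _) t) =
  step_integral (@vmeasure R k G _) [seq (p.1, msubset_preimage s p.2) | p <- t].
Proof.
rewrite contr_step_integral /step_integral big_map; apply: eq_bigr => p _ /=.
by rewrite pullback_vmeasure.
Qed.

Lemma L1_integral_natural X Y (s : mp_partial X Y) (u : L1 k Y) :
  pullback (B_functor F) s (L1_integral F u) =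
  L1_integral F (pullback (B_functor (L1_object R k)) s u).
Proof.
apply: L1_integral_unique => e e0; have [t ut] := step_dense_L1 u e0.
(* The pullback of a list approximating [u] approximates both sides, since pullbacks are
   contractions in L^1 and in [F]. *)
exists [seq (p.1, msubset_preimage s p.2) | p <- t].
rewrite -!pullback_step_integral -!contrB; split.
  exact: le_lt_trans (contr_norm _ _) ut.
apply: le_trans (contr_norm _ _) _.
exact: le_trans (L1_integralP F u t) (ltW ut).
Qed.

(** The constant 1 is itself a step function, so the error bound in [L1_integralP] is zero for
    it. *)
Lemma L1_integral_one X : L1_integral F (L1_one k X) = B_point F X.
Proof.
have := L1_integralP F (L1_one k X) [:: (1, msubsetT X)].
rewrite !step_integral_cons /step_integral !big_nil !addr0 !scale1r !vmeasureT.
by rewrite subrr normr0 normr_le0 subr_eq0 => /eqP.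
Qed.

Lemma B_hom_L1_integral (f : B_hom (L1_object R k) F) X (u : L1 k X) :
  (component f X : Defs.contraction _ _) u = L1_integral F u.
Proof.
pose h X : Defs.contraction (value (B_functor (L1_object R k)) X)
  (value (B_functor F) X) := component f X.
(* Naturality at the restriction to [A] moves the question to the subspace [A], where [f] preserves
   the point. *)
have h_chi A : h X (vmeasure (L1_object R k) A) = vmeasure F A.
  rewrite /vmeasure -(B_natP f).
  exact: (congr1 (fun g : Defs.contraction _ _ => g _) (naturality f (restriction A))).
apply: L1_integral_unique => e e0; have [s us] := step_dense_L1 u e0; exists s; split => //.
have -> : step_integral (@vmeasure R k F X) s = h X (step_integral (@vmeasure R k _ X) s).
  rewrite contr_step_integral; congr (step_integral _ s).
  by apply/funext => A; rewrite /= h_chi.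
rewrite -[X in `|X - _|]/(h X u) -contrB.
exact: le_trans (contr_norm _ _) (ltW us).
Qed.

Program Definition L1_integral_hom : B_hom (L1_object R k) F :=
  @BHom R k _ _ (@NatTrans (opposite (Mea R)) (Ban R k) _ _
    (@L1_integral_contraction R k F) _) _.
Next Obligation.
move=> Y X s; apply: contraction_ext => u; exact/esym/L1_integral_natural.
Qed.
Next Obligation. exact: L1_integral_one. Qed.

End Initiality.

Theorem theoremB (R : realType) (k : base_field) :
  @initial (B R k) (L1_object R k).
Proof.
move=> F; exists (L1_integral_hom F); split => // f _.
apply: B_hom_ext => X; apply: contraction_ext => u.
exact: esym (B_hom_L1_integral f u).
Qed.
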